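(* Let $\mathfrak{A}$ be a $C^*$-algebra, let $H$ be a Hilbert $\mathfrak{A}$-module, and let $\mathcal{L}(H)$ be the $C^*$-algebra of all adjointable operators on $H$. For every faithful representation $(\pi,X)$ of $\mathcal{L}(H)$, we have $$\widetilde{w}(T)=w\big(\pi(T)\big)\quad\text{for all } T\in\mathcal{L}(H).$$
   Context: A (right) Hilbert $\mathfrak{A}$-module $H$ is a right $\mathfrak{A}$-module with an $\mathfrak{A}$-valued inner product $\langle\cdot,\cdot\rangle$ (linear in the second variable, conjugate-linear in the first) that is complete in the norm $\|x\|=\sqrt{\|\langle x,x\rangle\|}$. $\mathcal{S}(\mathfrak{A})$ denotes the set of all states on $\mathfrak{A}$. The spatial numerical radius of $T\in\mathcal{L}(H)$ is $$\widetilde{w}(T)=\sup\{|\rho\langle x,Tx\rangle| : x\in H,\ \rho\in\mathcal{S}(\mathfrak{A}),\ \rho\langle x,x\rangle=1\}.$$ A representation of $\mathcal{L}(H)$ is a pair $(\pi,X)$ where $X$ is a (complex) Hilbert space and $\pi:\mathcal{L}(H)\to\mathbb{B}(X)$ is a $C^*$-morphism (a $*$-homomorphism) into the bounded operators on $X$; it is faithful if $\pi$ is injective. For $S\in\mathbb{B}(X)$, $w(S)=\sup\{|\langle Sx,x\rangle| : x\in X,\ \|x\|=1\}$ is the usual numerical radius. *)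

(* Defs.v *)
From HB Require Import structures.
From mathcomp Require Import all_boot all_order all_algebra.
From mathcomp Require Import sesquilinear complex.
From mathcomp Require Import all_classical all_reals all_analysis.

Set Implicit Arguments.
Unset Strict Implicit.
Unset Printing Implicit Defensive.

Import Order.TTheory GRing.Theory Num.Theory numFieldNormedType.Exports.
Import ComplexField.Normc.

Local Open Scope classical_set_scope.
Local Open Scope ring_scope.
Local Open Scope complex_scope.

(* MathComp rings are unital, whereas a C*-algebra need not be; hence the
   product is a separate operation on a Banach space. *)
HB.mixin Record isCstarAlgebra (R : realType) A
    of CompleteNormedModule R[i] A := {
  cmul : A -> A -> A;
  cstar : A -> A;
  cmulA : forall a b c, cmul a (cmul b c) = cmul (cmul a b) c;
  cmulDl : forall a b c, cmul (a + b) c = cmul a c + cmul b c;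
  cmulDr : forall a b c, cmul a (b + c) = cmul a b + cmul a c;
  cmulZl : forall (k : R[i]) a b, cmul (k *: a) b = k *: cmul a b;
  cmulZr : forall (k : R[i]) a b, cmul a (k *: b) = k *: cmul a b;
  cstarK : forall a, cstar (cstar a) = a;
  cstarD : forall a b, cstar (a + b) = cstar a + cstar b;
  cstarZ : forall (k : R[i]) a, cstar (k *: a) = Num.conj k *: cstar a;
  cstarM : forall a b, cstar (cmul a b) = cmul (cstar b) (cstar a);
  cnormM : forall a b, `|cmul a b| <= `|a| * `|b|;
  cnorm_star : forall a, `|cmul (cstar a) a| = `|a| ^+ 2
}.

#[short(type="cstarAlgType")]
HB.structure Definition CstarAlgebra (R : realType) :=
  {A of isCstarAlgebra R A & CompleteNormedModule R[i] A}.

Definition cpositive (R : realType) (A : cstarAlgType R) (a : A) : Prop :=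
  exists b : A, a = cmul (cstar b) b.

(* `sup` is 0 on unbounded sets, so the last condition includes continuity. *)
Definition is_state (R : realType) (A : cstarAlgType R)
    (rho : {scalar A}) : Prop :=
  (forall a : A, cpositive a -> 0 <= rho a) /\
  sup [set normc (rho a) | a in [set a : A | `|a| <= 1]] = 1.

HB.mixin Record isHilbertModule (R : realType) (A : cstarAlgType R) H
    of CompleteNormedModule R[i] H := {
  hact : H -> A -> H;
  hinner : H -> H -> A;
  hactDl : forall x y a, hact (x + y) a = hact x a + hact y a;
  hactDr : forall x a b, hact x (a + b) = hact x a + hact x b;
  hactM : forall x a b, hact x (cmul a b) = hact (hact x a) b;
  hactZl : forall (k : R[i]) x a, hact (k *: x) a = k *: hact x a;
  hactZr : forall (k : R[i]) x a, hact x (k *: a) = k *: hact x a;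
  hinnerDr : forall x y z, hinner x (y + z) = hinner x y + hinner x z;
  hinnerZr : forall (k : R[i]) x y, hinner x (k *: y) = k *: hinner x y;
  hinner_act : forall x y a, hinner x (hact y a) = cmul (hinner x y) a;
  hinner_star : forall x y, cstar (hinner x y) = hinner y x;
  hinner_ge0 : forall x, cpositive (hinner x x);
  hinner_eq0 : forall x, hinner x x = 0 -> x = 0;
  hnorm_inner : forall x, `|x| ^+ 2 = `|hinner x x|
}.

#[short(type="hilbertModType")]
HB.structure Definition HilbertModule (R : realType) (A : cstarAlgType R) :=
  {H of isHilbertModule R A H & CompleteNormedModule R[i] H}.

Section Adjointable.
Variables (R : realType) (A : cstarAlgType R) (H : hilbertModType A).
Implicit Types S T : H -> H.

Definition adjoint_of S T : Prop :=
  forall x y : H, hinner (S x) y = hinner x (T y) :> A.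

Definition adjointable : {pred H -> H} :=
  fun T => `[< exists S, adjoint_of S T >].

Lemma adjointable_sym S T : adjoint_of S T -> adjoint_of T S.
Proof. by move=> ST x y; rewrite -hinner_star -ST hinner_star. Qed.

Fact adjointable_submod : submod_closed adjointable.
Proof.
have z : GRing.zero \in adjointable.
  rewrite inE; exists (fun=> 0) => x y /=.
  have h0 u : hinner u 0 = 0 :> A by rewrite -(scale0r 0) hinnerZr scale0r.
  by rewrite h0 -hinner_star h0 -(scale0r 0) cstarZ conjC0 !scale0r.
split=> // k S T; rewrite !inE => -[S' SS] [T' TT].
exists (fun x => Num.conj k *: S' x + T' x); apply: adjointable_sym => x y.
rewrite hinnerDr hinnerZr -(adjointable_sym SS) -(adjointable_sym TT).
rewrite -hinner_star hinnerDr hinnerZr cstarD cstarZ.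
by rewrite !hinner_star.
Qed.

HB.instance Definition _ :=
  GRing.isSubmodClosed.Build _ _ adjointable adjointable_submod.

(* Linearity and boundedness are consequences of the existence of an adjoint.
   Only the *-algebra structure is set up, since a *-homomorphism does not
   involve the operator norm. *)
Record adjOp := AdjOp { adjOp_fun :> H -> H; _ : adjOp_fun \in adjointable }.

HB.instance Definition _ := [isSub for adjOp_fun].
HB.instance Definition _ := [Choice of adjOp by <:].
HB.instance Definition _ := [SubChoice_isSubLmodule of adjOp by <:].

Fact adjOp_comp_subproof (S T : adjOp) : (S : H -> H) \o T \in adjointable.
Proof.
have /asboolP[S' SS] := valP S; have /asboolP[T' TT] := valP T.
by apply/asboolP; exists (T' \o S') => x y /=; rewrite TT SS.
Qed.

Definition adjOp_comp (S T : adjOp) : adjOp := AdjOp (adjOp_comp_subproof S T).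

Fact adjOp_star_ex (T : adjOp) : exists S : adjOp, adjoint_of S T.
Proof.
case: T => [T Tadj]; have := Tadj; rewrite inE => -[S ST].
suff Sadj : S \in adjointable by exists (AdjOp Sadj).
by apply/asboolP; exists T; apply: adjointable_sym.
Qed.

Definition adjOp_star (T : adjOp) : adjOp := projT1 (cid (adjOp_star_ex T)).

Lemma adjOp_starP (T : adjOp) : adjoint_of (adjOp_star T) T.
Proof. exact: projT2 (cid (adjOp_star_ex T)). Qed.

(* `sup set0 = 0`, which gives 0 when H is the zero module; likewise for
   `numerical_radius` below. *)
Definition spatial_numerical_radius (T : adjOp) : R :=
  sup [set r : R | exists (x : H) (rho : {scalar A}),
    [/\ is_state rho, rho (hinner x x) = 1
      & r = normc (rho (hinner x (T x)))]].

End Adjointable.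

(* As in `{dot X for conjC}`, the inner product of a Hilbert space is linear in
   the first variable, unlike that of a Hilbert module. *)
HB.mixin Record isHilbertSpace (R : realType) X
    of CompleteNormedModule R[i] X := {
  dotp : {dot X for (@Num.conj R[i])};
  norm_dotp : forall x, `|x| ^+ 2 = dotp x x
}.

#[short(type="hilbertType")]
HB.structure Definition HilbertSpace (R : realType) :=
  {X of isHilbertSpace R X & CompleteNormedModule R[i] X}.

Section BoundedOperators.
Variables (R : realType) (X : hilbertType R).

Definition bounded_linear : {pred X -> X} := fun f =>
  `[< linear f /\ exists M : R[i], forall x, `|f x| <= M * `|x| >].

Fact bounded_linear_submod : submod_closed bounded_linear.
Proof.
split=> [|k f g /asboolP[lf [M fM]] /asboolP[lg [N gN]]]; apply/asboolP.
  split=> [k x y|]; first by rewrite scaler0 addr0.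
  by exists 0 => x; rewrite normr0 mul0r.
split=> [a x y|].
  rewrite /= !fctE lf lg !scalerDr !scalerA (mulrC k) !addrA; congr (_ + _).
  by rewrite -!addrA; congr (_ + _); rewrite addrC.
exists (`|k| * M + N) => x; rewrite mulrDl (le_trans (ler_normD _ _))//.
by rewrite lerD// normrZ -mulrA ler_wpM2l.
Qed.

HB.instance Definition _ :=
  GRing.isSubmodClosed.Build _ _ bounded_linear bounded_linear_submod.

Record bddOp :=
  BddOp { bddOp_fun :> X -> X; _ : bddOp_fun \in bounded_linear }.

HB.instance Definition _ := [isSub for bddOp_fun].
HB.instance Definition _ := [Choice of bddOp by <:].
HB.instance Definition _ := [SubChoice_isSubLmodule of bddOp by <:].

Fact bddOp_comp_subproof (S T : bddOp) :
  (S : X -> X) \o T \in bounded_linear.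
Proof.
have /asboolP[lS [M SM]] := valP S; have /asboolP[lT [N TN]] := valP T.
apply/asboolP; split=> [k x y|]; first by rewrite /= lT lS.
exists (`|M| * N) => x /=; apply: (le_trans (SM _)).
apply: (@le_trans _ _ (`|M| * `|T x|)).
  have [Tx0|Tx0] := eqVneq (T x) 0; first by rewrite Tx0 normr0 !mulr0.
  have Tx_gt0 : 0 < `|T x| by rewrite normr_gt0.
  rewrite ler_wpM2r// real_ler_norm//.
  have : 0 <= M * `|T x| by apply: le_trans (SM _).
  by rewrite pmulr_lge0// => /ger0_real.
by rewrite -mulrA ler_wpM2l.
Qed.

Definition bddOp_comp (S T : bddOp) : bddOp := BddOp (bddOp_comp_subproof S T).

Definition bdd_adjoint_of (S T : bddOp) : Prop :=
  forall x y : X, dotp (S x) y = dotp x (T y).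

Definition numerical_radius (S : bddOp) : R :=
  sup [set normc (dotp (S x) x) | x in [set x : X | `|x| = 1]].

End BoundedOperators.

(* Representations are not required to preserve the identity. *)
Record representation (R : realType) (A : cstarAlgType R)
    (H : hilbertModType A) (X : hilbertType R) := Representation {
  rep_fun :> {linear adjOp H -> bddOp X};
  rep_comp : forall S T : adjOp H,
    rep_fun (adjOp_comp S T) = bddOp_comp (rep_fun S) (rep_fun T);
  rep_star : forall T : adjOp H,
    bdd_adjoint_of (rep_fun (adjOp_star T)) (rep_fun T)
}.

Definition faithful (R : realType) (A : cstarAlgType R)
    (H : hilbertModType A) (X : hilbertType R)
    (pi : representation H X) : Prop := injective pi.

(* Main.v *)
Require Import Defs.
From HB Require Import structures.
From mathcomp Require Import all_boot all_order all_algebra.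
From mathcomp Require Import sesquilinear complex.
From mathcomp Require Import all_classical all_reals all_analysis.
From mathcomp Require Import ring.

Set Implicit Arguments.
Unset Strict Implicit.
Unset Printing Implicit Defensive.

Import Order.TTheory GRing.Theory Num.Theory numFieldNormedType.Exports.
Import ComplexField.Normc.

Local Open Scope classical_set_scope.
Local Open Scope ring_scope.
Local Open Scope complex_scope.

(** Both numerical radii are governed by positivity. Let [f] be a linear
    functional on the adjointable operators that is nonnegative on positive
    operators. The bound [`|f T| <= t * f 1] says that [f] is nonnegative on
    each self-adjoint operator [2 t - (l T + (l T)^* )] with [`|l| = 1]. So the
    bound for all members of a family of such functionals follows from the
    positivity of these operators, and implies it when the family detects
    positivity ([numerical_bound_transfer]). The spatial numerical radius of
    [T] is the best [t] for the functionals [T |-> rho <x, T x>], and the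
    numerical radius of [pi T] is the best [t] for [T |-> <pi T xi, xi>];
    hence it is enough that both families detect positivity.

    Positivity of operators on [H] is handled through square roots, which an
    explicit iteration provides ([psd_sqrt]). If [Z] is self-adjoint, [Q] the
    square root of [Z ^+ 2] and [n = Q - Z], then [n * Z * n = - (P * P)] for a
    self-adjoint [P] that vanishes only when [Z] is positive
    ([psd_or_negative]). A functional of either family that is nonnegative on
    [n * Z * n] is therefore zero on [P * P]. For the vector functionals this
    gives [pi P = 0], so [P = 0] because [pi] is injective. For the states of
    [A] it gives [P = 0] once each nonzero [z] in [H] has a state that is
    nonzero on [<z, z>].

    Such a state is obtained from [pi] as well: it is a multiple of
    [a |-> <pi (x |-> z a <z, x>) xi, xi>] ([exists_state]). It is positive
    because the operators [x |-> w <w, x>] are ([rank1_psd]). Here lies the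
    theorem of Kelley and Vaught that [d^* d] has a positive spectrum; it is
    proved for the left multiplications of [A], seen as operators on the
    Hilbert module [A], and then carried over to [H].

    Finally, adjointable operators are bounded, which positivity arguments
    presuppose. This too comes from [pi], as [pi T] is bounded and positivity
    passes through [pi] in both directions ([adjOp_bounded]). *)

(** * Inner products in Hilbert modules *)

Section CstarTheory.
Variables (R : realType) (A : cstarAlgType R).
Implicit Types a b : A.

Lemma cmulNl a b : cmul (- a) b = - cmul a b.
Proof. by rewrite -scaleN1r cmulZl scaleN1r. Qed.

Lemma cmulNr a b : cmul a (- b) = - cmul a b.
Proof. by rewrite -scaleN1r cmulZr scaleN1r. Qed.

Lemma cstarN a : cstar (- a) = - cstar a.
Proof. by rewrite -scaleN1r cstarZ rmorphN rmorph1 scaleN1r. Qed.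

Lemma cstar_norm a : `|cstar a| = `|a|.
Proof.
have le_star b : `|b| <= `|cstar b|.
  have [->|b0] := eqVneq b 0; first by rewrite normr0 normr_ge0.
  have b_gt0 : 0 < `|b| by rewrite normr_gt0.
  by rewrite -(ler_pM2r b_gt0) -expr2 -cnorm_star cnormM.
by apply/le_anti/andP; split; rewrite ?le_star// -{2}(cstarK a) le_star.
Qed.

Lemma cmul_star_eq0 a : cmul (cstar a) a = 0 -> a = 0.
Proof.
by move=> /(congr1 (fun x : A => `|x|)); rewrite cnorm_star normr0 => /eqP;
  rewrite sqrf_eq0 normr_eq0 => /eqP.
Qed.

End CstarTheory.

Section HilbertModuleTheory.
Variables (R : realType) (A : cstarAlgType R) (H : hilbertModType A).
Implicit Types (x y z : H) (a : A) (k : R[i]).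

Local Notation "<[ x , y ]>" := (hinner x y : A) (format "<[ x ,  y ]>").

Lemma hinnerDl x y z : <[x + y, z]> = <[x, z]> + <[y, z]>.
Proof. by rewrite -hinner_star hinnerDr cstarD !hinner_star. Qed.

Lemma hinnerZl k x y : <[k *: x, y]> = Num.conj k *: <[x, y]>.
Proof. by rewrite -hinner_star hinnerZr cstarZ !hinner_star. Qed.

Lemma hinner0r x : <[x, 0]> = 0.
Proof. by rewrite -(scale0r (0 : H)) hinnerZr !scale0r. Qed.

Lemma hinner0l x : <[0, x]> = 0.
Proof. by rewrite -(scale0r (0 : H)) hinnerZl conjC0 !scale0r. Qed.

Lemma hinnerNr x y : <[x, - y]> = - <[x, y]>.
Proof. by rewrite -scaleN1r hinnerZr scaleN1r. Qed.

Lemma hinnerNl x y : <[- x, y]> = - <[x, y]>.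
Proof. by rewrite -hinner_star hinnerNr cstarN hinner_star. Qed.

Lemma hinnerBr x y z : <[x, y - z]> = <[x, y]> - <[x, z]>.
Proof. by rewrite hinnerDr hinnerNr. Qed.

Lemma hinnerBl x y z : <[x - y, z]> = <[x, z]> - <[y, z]>.
Proof. by rewrite hinnerDl hinnerNl. Qed.

Lemma hinner_actl x y a : <[hact x a, y]> = cmul (cstar a) <[x, y]>.
Proof. by rewrite -hinner_star hinner_act cstarM hinner_star. Qed.

Lemma hinner_inj x y : (forall z, <[z, x]> = <[z, y]>) -> x = y.
Proof.
move=> xy; apply/eqP; rewrite -subr_eq0; apply/eqP; apply: hinner_eq0.
by rewrite hinnerBr xy subrr.
Qed.

Lemma hact_norm x a : `|hact x a| <= `|x| * `|a|.
Proof.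
rewrite -(@ler_pXn2r _ 2)// ?nnegrE ?mulr_ge0//.
rewrite hnorm_inner hinner_act hinner_actl exprMn hnorm_inner.
apply: (le_trans (cnormM _ _)); rewrite expr2 mulrA ler_wpM2r//.
by rewrite (le_trans (cnormM _ _))// cstar_norm mulrC.
Qed.

(** Polarization writes [2 <x, y>] with two sums [<u, v> + <v, u>], and on the
    unit ball such a sum has norm at most [2 ^+ 2 + 1 + 1]. *)
Lemma hinner_norm x y : `|<[x, y]>| <= 6 * (`|x| * `|y|).
Proof.
pose g (u v : H) : A := <[u, v]> + <[v, u]>.
have g_norm (u v : H) : `|u| <= 1 -> `|v| <= 1 -> `|g u v| <= 6.
  move=> u1 v1.
  have gE : g u v = <[u + v, u + v]> - (<[u, u]> + <[v, v]>).
    by rewrite /g hinnerDl !hinnerDr (addrC <[u, u]>) addrACA addrK.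
  have uv2 : `|u + v| <= 2.
    by apply: (le_trans (ler_normD _ _)); rewrite -[leRHS]/(1 + 1) lerD.
  rewrite gE; apply: (le_trans (ler_normB _ _)).
  have -> : 6 = 2 ^+ 2 + (1 + 1) :> R[i].
    by rewrite -[1 + 1]/(2%:R) -natrX -natrD.
  apply: lerD; first by rewrite -hnorm_inner lerXn2r// nnegrE.
  apply: (le_trans (ler_normD _ _)).
  by rewrite -!hnorm_inner lerD// exprn_ile1.
have polar (u v : H) : 2 *: <[u, v]> = g u v - 'i *: g u ('i *: v).
  rewrite /g hinnerZr hinnerZl conjCi scalerDr !scalerA mulrN -expr2 sqrCi.
  by rewrite opprK scaleN1r scale1r opprD opprK addrACA subrr addr0 scaler_nat.
have unit_norm (u v : H) : `|u| <= 1 -> `|v| <= 1 -> `|<[u, v]>| <= 6.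
  move=> u1 v1; rewrite -(@ler_pM2l _ 2)//.
  rewrite -{1}[2]ger0_norm// -normrZ polar (le_trans (ler_normB _ _))//.
  rewrite normrZ normCi mul1r mulrDl !mul1r lerD// g_norm//.
  by rewrite normrZ normCi mul1r.
have [->|x0] := eqVneq x 0; first by rewrite hinner0l !normr0 mul0r mulr0.
have [->|y0] := eqVneq y 0; first by rewrite hinner0r !normr0 !mulr0.
have nE (z : H) : z != 0 -> z = `|z| *: (`|z|^-1 *: z).
  by move=> z0; rewrite scalerA divff ?scale1r// normr_eq0.
have n1 (z : H) : z != 0 -> `| `|z|^-1 *: z| <= 1.
  by move=> z0; rewrite normrZ normfV normr_id mulVf// normr_eq0.
rewrite {1}(nE x x0) {1}(nE y y0) hinnerZl hinnerZr.
rewrite !normrZ norm_conjC !normr_id.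
by rewrite mulrA mulrC ler_wpM2r ?mulr_ge0 ?unit_norm ?n1.
Qed.

End HilbertModuleTheory.

(** * The algebra of adjointable operators *)

Section AdjointableRing.
Variables (R : realType) (A : cstarAlgType R) (H : hilbertModType A).
Implicit Types (S T U : adjOp H) (x y : H) (k : R[i]).

Local Notation "<[ x , y ]>" := (hinner x y : A) (format "<[ x ,  y ]>").

Lemma adjOpP S T : (forall x, S x = T x) -> S = T.
Proof. by move=> ST; apply/val_inj/funext. Qed.

Lemma adjOpD S T x : (S + T) x = S x + T x. Proof. by []. Qed.
Lemma adjOpN S x : (- S) x = - S x. Proof. by []. Qed.
Lemma adjOpB S T x : (S - T) x = S x - T x. Proof. by []. Qed.
Lemma adjOpZ k S x : (k *: S) x = k *: S x. Proof. by []. Qed.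
Lemma adjOp0 x : (0 : adjOp H) x = 0. Proof. by []. Qed.

Lemma adjOp_linear S : linear S.
Proof.
move=> k x y; apply: (@hinner_inj _ A H) => z.
by rewrite hinnerDr hinnerZr -!adjOp_starP hinnerDr hinnerZr.
Qed.

HB.instance Definition _ S :=
  GRing.isLinear.Build R[i] H H *:%R S (adjOp_linear S).

Lemma adjOp_fun0 S : S 0 = 0. Proof. exact: raddf0. Qed.
Lemma adjOp_funB S x y : S (x - y) = S x - S y. Proof. exact: raddfB. Qed.
Lemma adjOp_funZ S k x : S (k *: x) = k *: S x. Proof. exact: linearZ. Qed.

Fact adjOp_id_subproof : (idfun : H -> H) \in @adjointable _ _ H.
Proof. by apply/asboolP; exists idfun. Qed.

Definition adjOp_id : adjOp H := AdjOp adjOp_id_subproof.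

Fact adjOp_compA : associative (@adjOp_comp _ _ H).
Proof. by move=> S T U; apply: adjOpP. Qed.
Fact adjOp_comp1l : left_id adjOp_id (@adjOp_comp _ _ H).
Proof. by move=> S; apply: adjOpP. Qed.
Fact adjOp_comp1r : right_id adjOp_id (@adjOp_comp _ _ H).
Proof. by move=> S; apply: adjOpP. Qed.
Fact adjOp_compDl : left_distributive (@adjOp_comp _ _ H) +%R.
Proof. by move=> S T U; apply: adjOpP. Qed.
Fact adjOp_compDr : right_distributive (@adjOp_comp _ _ H) +%R.
Proof. by move=> S T U; apply: adjOpP => x /=; rewrite /= raddfD. Qed.

HB.instance Definition _ := GRing.Zmodule_isPzRing.Build (adjOp H)
  adjOp_compA adjOp_comp1l adjOp_comp1r adjOp_compDl adjOp_compDr.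

Lemma adjOpM S T x : (S * T) x = S (T x). Proof. by []. Qed.
Lemma adjOp1 x : (1 : adjOp H) x = x. Proof. by []. Qed.

Lemma adjOpZAl k S T : k *: S * T = k *: (S * T).
Proof. exact: adjOpP. Qed.
Lemma adjOpZAr k S T : S * (k *: T) = k *: (S * T).
Proof. by apply: adjOpP => x; rewrite !(adjOpM, adjOpZ) linearZ. Qed.

Definition selfadj S := adjoint_of S S.

Lemma selfadj0 : selfadj 0.
Proof. by move=> x y; rewrite !adjOp0 hinner0l hinner0r. Qed.
Lemma selfadj1 : selfadj 1. Proof. by []. Qed.

Lemma selfadjD S T : selfadj S -> selfadj T -> selfadj (S + T).
Proof. by move=> sS sT x y; rewrite !adjOpD hinnerDl hinnerDr sS sT. Qed.

Lemma selfadjZ k S : k \is Num.real -> selfadj S -> selfadj (k *: S).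
Proof.
by move=> /CrealP kr sS x y; rewrite !adjOpZ hinnerZl hinnerZr kr sS.
Qed.

Lemma selfadjN S : selfadj S -> selfadj (- S).
Proof. by move=> sS x y; rewrite !adjOpN hinnerNl hinnerNr sS. Qed.

Lemma selfadjB S T : selfadj S -> selfadj T -> selfadj (S - T).
Proof. by move=> sS sT; apply/selfadjD/selfadjN. Qed.

Lemma selfadjM S T :
  GRing.comm S T -> selfadj S -> selfadj T -> selfadj (S * T).
Proof. by move=> cST sS sT x y; rewrite {2}cST !adjOpM sS sT. Qed.

Lemma selfadj_sqr S : selfadj S -> selfadj (S ^+ 2).
Proof. by move=> sS; rewrite expr2; apply: selfadjM. Qed.

Definition contraction S := forall x, `|S x| <= `|x|.

Lemma contraction1 : contraction 1. Proof. by []. Qed.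

Lemma contractionM S T : contraction S -> contraction T -> contraction (S * T).
Proof. by move=> cS cT x; apply: le_trans (cS _) (cT x). Qed.

Lemma contractionN S : contraction S -> contraction (- S).
Proof. by move=> cS x; rewrite adjOpN normrN. Qed.

Lemma contraction_convex k S T : 0 <= k -> k <= 1 ->
  contraction S -> contraction T -> contraction (k *: S + (1 - k) *: T).
Proof.
move=> k0 k1 cS cT x; rewrite adjOpD !adjOpZ (le_trans (ler_normD _ _))//.
rewrite !normrZ !ger0_norm ?subr_ge0//.
have -> : `|x| = k * `|x| + (1 - k) * `|x| by rewrite -mulrDl subrKC mul1r.
by rewrite lerD// ler_wpM2l ?subr_ge0.
Qed.

End AdjointableRing.

(** * Square roots of positive operators *)

Section MajorizedSequences.
Variable R : realType.
Implicit Types (r : nat -> R) (l : R) (K : R[i]).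

Lemma majorant_small r l K (e : R[i]) : r @ \oo --> l -> 0 <= K -> 0 < e ->
  exists N, forall n, (N <= n)%N -> (l - r n)%:C * K < e.
Proof.
move=> rl K0 e0.
have K1 : 0 < K + 1 by rewrite ltr_wpDl.
have e1 : 0 < e / (K + 1) by rewrite divr_gt0.
move/cvgrPdist_lt : rl => /(_ (complex.Re (e / (K + 1)))).
rewrite -ltcR RRe_real ?gtr0_real// => /(_ e1) [N _ Ne].
exists N => n /Ne /=; rewrite -ltcR RRe_real ?gtr0_real// => lrn.
have lrn' : (l - r n)%:C < e / (K + 1).
  by apply: le_lt_trans lrn; rewrite lecR ler_norm.
apply: (@le_lt_trans _ _ (e / (K + 1) * K)); first by rewrite ler_wpM2r// ltW.
by rewrite -mulrA gtr_pMr// mulrC ltr_pdivrMr// mul1r ltrDl.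
Qed.

Lemma majorant_eq0 (V : normedModType R[i]) r l K (u : V) :
  r @ \oo --> l -> 0 <= K -> (forall n, `|u| <= (l - r n)%:C * K) -> u = 0.
Proof.
move=> rl K0 uK; apply: contrapT => /eqP; rewrite -normr_gt0 => u0.
have [N /(_ N (leqnn N))] := majorant_small rl K0 u0.
by move=> /(le_lt_trans (uK N)); rewrite ltxx.
Qed.

(** The explicit rate of convergence is what [majorant_eq0] takes as input, so
    that identities between limits need no further topology. *)
Lemma majorant_cvg (V : completeNormedModType R[i]) r l K (u : nat -> V) :
  {homo r : m n / (m <= n)%N >-> m <= n} -> r @ \oo --> l -> 0 <= K ->
  (forall m n, (n <= m)%N -> `|u m - u n| <= (r m - r n)%:C * K) ->
  exists v, forall n, `|v - u n| <= (l - r n)%:C * K.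
Proof.
move=> r_nd rl K0 uK.
have rle n : r n <= l.
  have -> : l = limn r by apply/esym/cvg_lim.
  by apply: nondecreasing_cvgn_le => //; apply/cvg_ex; exists l.
have uKl m n : (n <= m)%N -> `|u m - u n| <= (l - r n)%:C * K.
  by move=> /uK /le_trans; apply; rewrite ler_wpM2r// lecR lerB.
have /cvg_ex[v uv] : cvg (u @ \oo).
  apply: cauchy_cvg; apply: cauchy_exP => e e0.
  have [N /(_ N (leqnn N)) Ne] := majorant_small rl K0 e0.
  exists (u N), N => // n /= Nn; rewrite -ball_normE /= distrC.
  exact: le_lt_trans (uKl _ _ Nn) Ne.
exists v => n; apply/ler_addgt0Pr => e e0.
move/cvgrPdist_lt : uv => /(_ e e0)[N _ Ne].
have := Ne (maxn N n) (leq_maxl _ _) => /= /ltW ve.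
rewrite -(subrKA (u (maxn N n))) (le_trans (ler_normD _ _))// addrC lerD//.
exact: uKl (leq_maxr _ _).
Qed.

End MajorizedSequences.

Section SquareRoot.
Variables (R : realType) (A : cstarAlgType R) (H : hilbertModType A).
Implicit Types (S T X Y : adjOp H) (k : R[i]).

(** The operator iteration below at [Y = 1], over the reals: it increases and
    stays below 1, and it dominates the norms of the operator iteration and of
    its increments. *)
Fixpoint sqrt_majorant n : R :=
  if n is m.+1 then 2^-1 * (1 + sqrt_majorant m ^+ 2) else 0.

Local Notation r := sqrt_majorant.

Lemma sqrt_majorantS n : r n.+1 = 2^-1 * (1 + r n ^+ 2). Proof. by []. Qed.

Lemma sqrt_majorant_ge0 n : 0 <= r n.
Proof. by case: n => //= n; rewrite mulr_ge0// addr_ge0// sqr_ge0. Qed.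

Lemma sqrt_majorant_nd : {homo r : m n / (m <= n)%N >-> m <= n}.
Proof.
apply/nondecreasing_seqP => n; rewrite -subr_ge0 /=.
have -> : 2^-1 * (1 + r n ^+ 2) - r n = 2^-1 * (1 - r n) ^+ 2 by field.
by rewrite mulr_ge0// sqr_ge0.
Qed.

Lemma sqrt_majorant_le1 n : r n <= 1.
Proof.
elim: n => //= n rn; rewrite mulrC ler_pdivrMr// mul1r.
by rewrite -[2]/(1 + 1) lerD// exprn_ile1// sqrt_majorant_ge0.
Qed.

Lemma sqrt_majorant_cvg : exists l : R, r @ \oo --> l.
Proof.
apply/cvg_ex; apply: nondecreasing_is_cvgn; first exact: sqrt_majorant_nd.
by exists 1 => _ [n _ <-]; apply: sqrt_majorant_le1.
Qed.

Section Iteration.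
Variable Y : adjOp H.
Hypotheses (saY : selfadj Y) (cY : contraction Y).

(** Fixed points satisfy [2 X = Y + X ^+ 2], that is [(1 - X) ^+ 2 = 1 - Y]. *)
Fixpoint sqrt_iter n : adjOp H :=
  if n is m.+1 then 2^-1 *: (Y + sqrt_iter m ^+ 2) else 0.

Local Notation u := sqrt_iter.

Lemma sqrt_iterS n : u n.+1 = 2^-1 *: (Y + u n ^+ 2). Proof. by []. Qed.

Lemma sqrt_iter_comm S n : GRing.comm S Y -> GRing.comm S (u n).
Proof.
move=> cSY; elim: n => [|n IH] /=; first exact: commr0.
rewrite /GRing.comm adjOpZAl adjOpZAr; congr (_ *: _).
exact/commrD/commrX.
Qed.

Lemma sqrt_iter_commY m n : GRing.comm (u m) (u n).
Proof.
apply: sqrt_iter_comm; apply: commr_sym; apply: sqrt_iter_comm.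
exact: commr_refl.
Qed.

Lemma sqrt_iter_selfadj n : selfadj (u n).
Proof.
elim: n => [|n IH] /=; first exact: selfadj0.
apply: selfadjZ; first by rewrite realV realn.
exact/selfadjD/selfadj_sqr.
Qed.

Lemma sqrt_iter_norm n x : `|u n x| <= (r n)%:C * `|x|.
Proof.
elim: n x => [|n IH] x; first by rewrite adjOp0 normr0 mul0r.
rewrite sqrt_iterS sqrt_majorantS adjOpZ adjOpD expr2 adjOpM normrZ normfV.
rewrite normr_nat rmorphM fmorphV rmorph_nat -mulrA ler_wpM2l//.
rewrite rmorphD rmorph1 mulrDl mul1r.
rewrite (le_trans (ler_normD _ _))// lerD// rmorphXn expr2 -mulrA.
by rewrite (le_trans (IH _))// ler_wpM2l// lecR sqrt_majorant_ge0.
Qed.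

Lemma sqrt_iter_step n x :
  `|u n.+1 x - u n x| <= (r n.+1 - r n)%:C * `|x|.
Proof.
rewrite -adjOpB; elim: n x => [|n IH] x.
  by rewrite subr0 (le_trans (sqrt_iter_norm 1 x))// subr0.
have -> : u n.+2 - u n.+1 = 2^-1 *: ((u n.+1 - u n) * (u n.+1 + u n)).
  rewrite mulrDr !mulrBl (sqrt_iter_commY n.+1 n) -!expr2 addrA subrK.
  rewrite (sqrt_iterS n.+1) {2}(sqrt_iterS n) -scalerBr.
  by rewrite opprD addrACA subrr add0r.
have -> : r n.+2 - r n.+1 = 2^-1 * ((r n.+1 - r n) * (r n.+1 + r n)).
  by rewrite (sqrt_majorantS n.+1) (sqrt_majorantS n); field.
rewrite adjOpZ normrZ normfV normr_nat rmorphM fmorphV rmorph_nat -mulrA.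
rewrite ler_wpM2l// adjOpM (le_trans (IH _))// rmorphM -mulrA ler_wpM2l//.
  by rewrite lecR subr_ge0 sqrt_majorant_nd.
rewrite adjOpD (le_trans (ler_normD _ _))// rmorphD mulrDl.
by rewrite lerD// sqrt_iter_norm.
Qed.

Lemma sqrt_iter_dist m n x : (n <= m)%N ->
  `|u m x - u n x| <= (r m - r n)%:C * `|x|.
Proof.
move=> /subnK <-; elim: (m - n)%N => [|k IH].
  by rewrite !subrr normr0 mul0r.
rewrite addSn -(subrKA (u (k + n)%N x)) (le_trans (ler_normD _ _))//.
rewrite -(subrKA (r (k + n)%N)) rmorphD mulrDl.
by rewrite lerD// sqrt_iter_step.
Qed.

End Iteration.

(** [X] is the pointwise limit of the iteration. It is adjointable because the
    iterates are self-adjoint and the inner product is continuous. *)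
Lemma sqrt_contraction Y : selfadj Y -> contraction Y ->
  exists X, [/\ selfadj X, contraction X, X + X = Y + X ^+ 2
    & forall S, GRing.comm S Y -> GRing.comm S X].
Proof.
move=> saY cY.
have [l rl] := sqrt_majorant_cvg.
have rle n : r n <= l.
  have -> : l = limn r by apply/esym/cvg_lim.
  apply: nondecreasing_cvgn_le; first exact: sqrt_majorant_nd.
  by apply/cvg_ex; exists l.
have l1 : l <= 1.
  have -> : l = limn r by apply/esym/cvg_lim.
  apply: limr_le; first by apply/cvg_ex; exists l.
  by apply: nearW => n; apply: sqrt_majorant_le1.
have rc0 n : 0 <= (l - r n)%:C by rewrite lecR subr_ge0.
pose u := sqrt_iter Y.
have lim x : exists v, forall n, `|v - u n x| <= (l - r n)%:C * `|x|.
  apply: (majorant_cvg sqrt_majorant_nd rl) => // m n.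
  exact: sqrt_iter_dist.
pose X0 x := projT1 (cid (lim x)).
have X0P x n : `|X0 x - u n x| <= (l - r n)%:C * `|x|.
  by rewrite /X0; case: cid.
have saX0 : adjoint_of X0 X0.
  move=> x y; apply/eqP; rewrite -subr_eq0; apply/eqP.
  apply: (@majorant_eq0 _ _ r l (12 * (`|x| * `|y|)) _ rl).
    by rewrite !mulr_ge0.
  move=> n.
  have -> : (hinner (X0 x) y : A) - hinner x (X0 y) =
      hinner (X0 x - u n x) y - hinner x (X0 y - u n y).
    rewrite hinnerBl hinnerBr opprB addrA; congr (_ - _).
    by rewrite sqrt_iter_selfadj// subrK.
  rewrite (le_trans (ler_normB _ _))//.
  have -> : 12 = 6 + 6 :> R[i] by rewrite -natrD.
  rewrite mulrDl mulrDr; apply: lerD; rewrite (le_trans (hinner_norm _ _))//.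
    by rewrite [leRHS]mulrCA ler_wpM2l// [leRHS]mulrA ler_wpM2r.
  by rewrite [leRHS]mulrCA ler_wpM2l// [leRHS]mulrCA ler_wpM2l.
have X0adj : X0 \in @adjointable _ _ H by apply/asboolP; exists X0.
pose X : adjOp H := AdjOp X0adj.
have XP x n : `|X x - u n x| <= (l - r n)%:C * `|x| by apply: X0P.
have u_norm n x : `|u n x| <= `|x|.
  rewrite (le_trans (sqrt_iter_norm cY n x))// ler_piMl//.
  by rewrite lecR sqrt_majorant_le1.
have cX : contraction X.
  move=> x; rewrite -[leRHS]mul1r.
  apply: (@le_trans _ _ (l%:C * `|x|)); last by rewrite ler_wpM2r ?lecR.
  by have := XP x 0; rewrite !subr0.
exists X; split => //.
- apply: adjOpP => x; apply/eqP; rewrite -subr_eq0; apply/eqP.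
  (* the recurrence [2 u_(n+1) = Y + u_n ^+ 2] is subtracted *)
  apply: (@majorant_eq0 _ _ r l (2 * `|x| + (`|X x| + `|x|)) _ rl).
    by rewrite !addr_ge0 ?mulr_ge0.
  move=> n; have uS : u n.+1 x + u n.+1 x = Y x + u n (u n x).
    have half2 : 2^-1 + 2^-1 = 1 :> R[i] by rewrite [RHS]splitr div1r.
    by rewrite /u sqrt_iterS adjOpZ -scalerDl half2 scale1r adjOpD expr2.
  have -> : (X + X) x - (Y + X ^+ 2) x =
     (X x - u n.+1 x) + (X x - u n.+1 x)
       - ((X (X x) - u n (X x)) + u n (X x - u n x)).
    rewrite addrACA -opprD uS expr2 adjOp_funB subrKA !adjOpD adjOpM.
    rewrite -[RHS]addrA.
    by rewrite -opprD -(addrA (Y x)) subrKC.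
  rewrite (le_trans (ler_normB _ _))// mulrDr lerD//.
    rewrite (le_trans (ler_normD _ _))// -mulr2n -[leLHS]mulr_natl.
    rewrite [leRHS]mulrCA ler_wpM2l//.
    by rewrite (le_trans (XP _ _))// ler_wpM2r// lecR lerB// sqrt_majorant_nd.
  rewrite (le_trans (ler_normD _ _))// mulrDr lerD//.
  by rewrite (le_trans (u_norm _ _)).
- (* as [S] may be unbounded, its adjoint is moved to the left argument before
     passing to the limit *)
  move=> S cSY; apply: adjOpP => x.
  apply: (@hinner_inj _ A H) => w; apply/eqP; rewrite -subr_eq0; apply/eqP.
  pose K : R[i] := 6 * (`|adjOp_star S w| * `|x|) + 6 * (`|w| * `|S x|).
  apply: (@majorant_eq0 _ _ r l K _ rl); first by rewrite addr_ge0// !mulr_ge0.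
  move=> n; rewrite !adjOpM.
  have -> : (hinner w (S (X x)) : A) - hinner w (X (S x)) =
      hinner (adjOp_star S w) (X x - u n x) - hinner w (X (S x) - u n (S x)).
    rewrite !hinnerBr !adjOp_starP opprB.
    have /(congr1 (fun T : adjOp H => T x)) := sqrt_iter_comm n cSY.
    by rewrite -/u !adjOpM => ->; rewrite subrKA.
  rewrite (le_trans (ler_normB _ _))// mulrDr; apply: lerD;
    rewrite (le_trans (hinner_norm _ _))// [leRHS]mulrCA ler_wpM2l//;
    by rewrite [leRHS]mulrCA ler_wpM2l.
Qed.

End SquareRoot.

(** * Positive operators *)

Section PositiveOperators.
Variables (R : realType) (A : cstarAlgType R) (H : hilbertModType A).
Implicit Types (S T Q s v : adjOp H) (x y : H) (k t : R[i]).

Definition op_bounded S :=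
  exists2 k : R[i], 0 < k & forall x, `|S x| <= k * `|x|.

Lemma contraction_bounded S : contraction S -> op_bounded S.
Proof. by move=> cS; exists 1 => // x; rewrite mul1r. Qed.

Lemma op_boundedM S T : op_bounded S -> op_bounded T -> op_bounded (S * T).
Proof.
move=> [k k0 Sk] [l l0 Tl]; exists (k * l); first exact: mulr_gt0.
by move=> x; rewrite adjOpM (le_trans (Sk _))// -mulrA ler_wpM2l// ltW.
Qed.

Lemma op_boundedD S T : op_bounded S -> op_bounded T -> op_bounded (S + T).
Proof.
move=> [k k0 Sk] [l l0 Tl]; exists (k + l); first exact: addr_gt0.
by move=> x; rewrite adjOpD (le_trans (ler_normD _ _))// mulrDl lerD.
Qed.

Lemma op_boundedZ k S : op_bounded S -> op_bounded (k *: S).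
Proof.
move=> [l l0 Sl]; exists ((`|k| + 1) * l).
  by rewrite mulr_gt0// ltr_wpDl.
move=> x; rewrite adjOpZ normrZ -mulrA ler_pM// ?Sl//.
by rewrite lerDl.
Qed.

Lemma op_boundedN S : op_bounded S -> op_bounded (- S).
Proof. by rewrite -scaleN1r; apply: op_boundedZ. Qed.

Lemma op_bounded_common S T : op_bounded S -> op_bounded T ->
  exists2 k : R[i], 0 < k &
    (forall x, `|S x| <= k * `|x|) /\ (forall x, `|T x| <= k * `|x|).
Proof.
move=> [k k0 Sk] [l l0 Tl]; exists (k + l); first exact: addr_gt0.
split=> x; rewrite mulrDl.
  by rewrite (le_trans (Sk x))// lerDl mulr_ge0// ltW.
by rewrite (le_trans (Tl x))// lerDr mulr_ge0// ltW.
Qed.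

Lemma selfadj_sqr_eq0 S : selfadj S -> S * S = 0 -> S = 0.
Proof.
move=> saS S0; apply: adjOpP => x; apply: (@hinner_eq0 _ A H).
by rewrite saS -adjOpM S0 adjOp0 hinner0r.
Qed.

(** The operators [s + i v] and [s - i v] are isometries, and [s] is their
    mean. *)
Lemma contraction_pythagoras s v : selfadj s -> selfadj v -> GRing.comm s v ->
  s ^+ 2 + v ^+ 2 = 1 -> contraction s.
Proof.
move=> sas sav csv sv1 x.
have iso (e : R[i]) : Num.conj e = - e -> e * e = -1 ->
    `|s x + e *: v x| = `|x|.
  move=> ce ee; apply/eqP; rewrite -(eqrXn2 (n := 2))//.
  rewrite !hnorm_inner; apply/eqP; congr (`|_|).
  rewrite !hinnerDl !hinnerDr !hinnerZl !hinnerZr !(sas, sav) ce.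
  rewrite -[s (v x)]/((s * v) x) csv adjOpM scalerA mulNr ee opprK scale1r.
  rewrite scaleNr addrA addrK.
  by rewrite -hinnerDr -!adjOpM -!expr2 -adjOpD sv1.
rewrite -(@ler_pM2l _ 2)// -{1}[2]ger0_norm// -normrZ scaler_nat mulr2n.
have -> : s x + s x = (s x + 'i *: v x) + (s x + (- 'i) *: v x).
  by rewrite scaleNr addrACA subrr addr0.
have ii : 'i * 'i = -1 :> R[i] by rewrite -expr2 sqrCi.
rewrite (le_trans (ler_normD _ _))// (iso 'i)// ?conjCi//.
rewrite (iso (- 'i)) ?mulrNN//.
  by rewrite -mulr2n mulr_natl.
by rewrite rmorphN; congr (- _); apply: conjCi.
Qed.

(** A bounded self-adjoint [S] is positive exactly when a positive multiple of
    it is at distance at most 1 from the identity. This form of positivity is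
    visibly stable under sums, and it feeds the square root iteration. *)
Definition psd S :=
  selfadj S /\ exists2 t : R[i], 0 < t & contraction (1 - t *: S).

Lemma psd_selfadj S : psd S -> selfadj S. Proof. by case. Qed.

Lemma psd0 : psd 0.
Proof.
by split; [exact: selfadj0 | exists 1; rewrite // scaler0 subr0].
Qed.

Lemma psdD S T : psd S -> psd T -> psd (S + T).
Proof.
move=> [saS [t t0 cS]] [saT [w w0 cT]]; split; first exact: selfadjD.
have tw0 : 0 < t + w by rewrite addr_gt0.
have tw1 : t / (t + w) <= 1 by rewrite ler_pdivrMr// mul1r lerDl ltW.
exists (t * w / (t + w)); first by rewrite divr_gt0// mulr_gt0.
have -> : 1 - (t * w / (t + w)) *: (S + T) =
    (t / (t + w)) *: (1 - w *: T) + (1 - t / (t + w)) *: (1 - t *: S).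
  have tw : t + w != 0 by rewrite gt_eqF.
  rewrite !scalerBr !scalerA addrACA -scalerDl subrKC scale1r -opprD.
  congr (_ - _); rewrite scalerDr [RHS]addrC.
  by congr (_ + _); congr (_ *: _); field.
by apply: contraction_convex => //; rewrite ltW// divr_gt0.
Qed.

Lemma psdZ k S : 0 < k -> psd S -> psd (k *: S).
Proof.
move=> k0 [saS [t t0 cS]]; split.
  by apply: selfadjZ => //; apply: gtr0_real.
by exists (t / k); rewrite ?divr_gt0// scalerA divfK// gt_eqF.
Qed.

Lemma psd_bounded S : psd S -> op_bounded S.
Proof.
move=> [saS [t t0 cS]].
have -> : S = t^-1 *: (1 - (1 - t *: S)).
  by rewrite opprB subrKC scalerA mulVf ?gt_eqF// scale1r.
apply/op_boundedZ/op_boundedD; first exact/contraction_bounded/contraction1.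
exact/op_boundedN/contraction_bounded.
Qed.

Lemma contraction_psd S : selfadj S -> contraction S -> psd (1 - S).
Proof.
move=> saS cS; split; first by apply: selfadjB => //; apply: selfadj1.
by exists 1; rewrite // scale1r opprB subrKC.
Qed.

Lemma psd1 : psd 1.
Proof.
rewrite -[1]subr0; apply: contraction_psd; first exact: selfadj0.
by move=> x; rewrite adjOp0 normr0.
Qed.

Lemma psd_norm_sub S k : selfadj S -> 0 <= k ->
  (forall x, `|S x| <= k * `|x|) -> psd (k *: (1 : adjOp H) - S).
Proof.
move=> saS; rewrite le0r => /orP[/eqP-> S0|k0 Sk].
  suff -> : S = 0 by rewrite scale0r subr0; exact: psd0.
  apply: adjOpP => x; apply/eqP; rewrite -normr_le0.
  by rewrite (le_trans (S0 x))// mul0r.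
have -> : k *: (1 : adjOp H) - S = k *: (1 - k^-1 *: S).
  by rewrite scalerBr scalerA divff ?gt_eqF// scale1r.
apply: psdZ => //; apply: contraction_psd.
  by apply: selfadjZ => //; rewrite realV gtr0_real.
move=> x; rewrite adjOpZ normrZ gtr0_norm ?invr_gt0// mulrC.
by rewrite ler_pdivrMr// mulrC.
Qed.

(** The iteration for [Y = 1 - t S] has a limit [X] with
    [(1 - X) ^+ 2 = t S]. *)
Lemma psd_sqrt S : psd S -> exists Q,
  [/\ psd Q, Q * Q = S & forall T, GRing.comm T S -> GRing.comm T Q].
Proof.
move=> [saS [t t0 cS]].
have tr : t \is Num.real by apply: gtr0_real.
have saY : selfadj (1 - t *: S).
  by apply: selfadjB; [exact: selfadj1 | exact: selfadjZ].
have [X [saX cX XE commX]] := sqrt_contraction saY cS.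
have s0 : 0 < sqrtC t by rewrite sqrtC_gt0.
exists ((sqrtC t)^-1 *: (1 - X)); split.
- by apply: psdZ; rewrite ?invr_gt0//; apply: contraction_psd.
- rewrite adjOpZAl adjOpZAr scalerA -invfM -expr2 sqrtCK.
  have -> : (1 - X) * (1 - X) = t *: S.
    rewrite mulrBr mulr1 mulrBl mul1r opprB addrACA -opprD XE -expr2.
    by rewrite opprD addrACA subrr addr0 subKr.
  by rewrite scalerA mulVf ?gt_eqF// scale1r.
- move=> T cTS; rewrite /GRing.comm adjOpZAl adjOpZAr; congr (_ *: _).
  apply: commrB; first exact: commr1.
  apply: commX; apply: commrB; first exact: commr1.
  by rewrite /GRing.comm adjOpZAl adjOpZAr cTS.
Qed.

(** The root [v] of [1 - s ^+ 2] is a contraction by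
    [contraction_pythagoras], and then so is its square. *)
Lemma contraction_sqr_compl s : selfadj s -> contraction s ->
  contraction (1 - s ^+ 2).
Proof.
move=> sas cs.
have sas2 : selfadj (s ^+ 2) by apply: selfadj_sqr.
have cs2 : contraction (s ^+ 2) by rewrite expr2; apply: contractionM.
have [v [[sav _] vE cv]] := psd_sqrt (contraction_psd sas2 cs2).
have csv : GRing.comm s v.
  by apply: cv; apply: commrB; [exact: commr1 | exact/commrX/commr_refl].
rewrite -vE; suff c : contraction v by apply: contractionM.
apply: (@contraction_pythagoras v s) => //.
by rewrite [v ^+ 2]expr2 vE subrK.
Qed.

Lemma psd_sqr s : selfadj s -> op_bounded s -> psd (s * s).
Proof.
move=> sas [k k0 sk]; rewrite -expr2; split; first exact: selfadj_sqr.
exists (k^-1 ^+ 2); first by rewrite exprn_gt0 ?invr_gt0.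
have -> : k^-1 ^+ 2 *: s ^+ 2 = (k^-1 *: s) ^+ 2.
  by rewrite !expr2 adjOpZAl adjOpZAr scalerA.
apply: contraction_sqr_compl.
  by apply: selfadjZ => //; rewrite realV gtr0_real.
move=> x; rewrite adjOpZ normrZ gtr0_norm ?invr_gt0// mulrC.
by rewrite ler_pdivrMr// mulrC.
Qed.

Lemma contraction_of_sqr s : selfadj s -> psd (1 - s ^+ 2) -> contraction s.
Proof.
move=> sas /psd_sqrt[v [[sav _] vE cv]].
apply: (@contraction_pythagoras s v) => //.
  by apply: cv; apply: commrB; [exact: commr1 | exact/commrX/commr_refl].
by rewrite [v ^+ 2]expr2 vE subrKC.
Qed.

Lemma psd_le1_sqrt S : psd S -> psd (1 - S) ->
  exists Q, [/\ selfadj Q, contraction Q & Q * Q = S].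
Proof.
move=> /psd_sqrt[Q [[saQ _] QE _]] S1; exists Q; split => //.
by apply: contraction_of_sqr; rewrite // expr2 QE.
Qed.

Lemma psd_le_norm S k : 0 < k -> psd S -> psd (k *: (1 : adjOp H) - S) ->
  forall x, `|S x| <= k * `|x|.
Proof.
move=> k0 pS pkS; have k1 : 0 < k^-1 by rewrite invr_gt0.
have [|Q [_ cQ QE]] := psd_le1_sqrt (psdZ k1 pS).
  have -> : 1 - k^-1 *: S = k^-1 *: (k *: (1 : adjOp H) - S).
    by rewrite scalerBr scalerA mulVf ?gt_eqF// scale1r.
  exact: psdZ.
have -> : S = k *: (Q * Q) by rewrite QE scalerA divff ?gt_eqF// scale1r.
move=> x; rewrite adjOpZ normrZ gtr0_norm// ler_wpM2l ?(ltW k0)//.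
exact: contractionM.
Qed.

Lemma psdM S T : GRing.comm S T -> psd S -> psd T -> psd (S * T).
Proof.
move=> cST pS pT.
have [Q [pQ QE cQ]] := psd_sqrt pS; have [P [pP PE cP]] := psd_sqrt pT.
have cPQ : GRing.comm Q P.
  by apply: cP; apply: commr_sym; apply: cQ; apply: commr_sym.
have -> : S * T = (Q * P) * (Q * P).
  by rewrite -QE -PE -!mulrA; congr (_ * _); rewrite !mulrA cPQ.
apply: psd_sqr; first by apply: selfadjM => //; apply: psd_selfadj.
by apply: op_boundedM; apply: psd_bounded.
Qed.

(** With [Q] the absolute value of [Z], the operator [n := Q - Z] is twice the
    negative part of [Z], so [n * Z * n] is a negative multiple of its cube.
    Thus [Z] is positive as soon as it is not negative in the direction of
    [n]. *)
Lemma psd_or_negative Z : selfadj Z -> op_bounded Z ->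
  exists n P : adjOp H, [/\ selfadj n, selfadj P /\ op_bounded P,
    n * Z * n = - (P * P) & (P = 0 -> psd Z)].
Proof.
move=> saZ bZ.
have [Q [pQ QE cQ]] := psd_sqrt (psd_sqr saZ bZ).
have cZQ : GRing.comm Z Q by apply: cQ; apply: commrM; exact: commr_refl.
have [P [pP PE cP]] := psd_sqrt pQ.
have saQ := psd_selfadj pQ; have saP := psd_selfadj pP.
have [n nE] : exists n, n = Q - Z by eexists.
have cnP : GRing.comm n P.
  rewrite nE; apply: cP; apply: commr_sym.
  by apply: commrB; [exact: commr_refl | exact: commr_sym].
have san : selfadj n by rewrite nE; apply: selfadjB.
have Zn : Z * n = - (Q * n) by rewrite nE !mulrBr opprB QE cZQ.
have bn : op_bounded n.
  by rewrite nE; apply: op_boundedD; [exact: psd_bounded | exact: op_boundedN].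
exists n, (P * n); split => //.
- by split; [exact: selfadjM | exact/op_boundedM/bn/psd_bounded].
- rewrite -mulrA Zn mulrN -PE -!mulrA.
  by congr (- _); rewrite [LHS]mulrA [in LHS]cnP mulrA.
- move=> P0; have Qn : Q * n = 0 by rewrite -PE -mulrA P0 mulr0.
  suff n0 : n = 0 by move/eqP : nE; rewrite n0 eq_sym subr_eq0 => /eqP <-.
  by apply: selfadj_sqr_eq0; rewrite // {1}nE mulrBl Zn Qn oppr0 subr0.
Qed.

End PositiveOperators.

(** * Rank one operators *)

Section RankOne.
Variables (R : realType) (A : cstarAlgType R) (H : hilbertModType A).
Implicit Types (S T : adjOp H) (u v w x y : H) (a : A) (k : R[i]).

Local Notation "<[ x , y ]>" := (hinner x y : A) (format "<[ x ,  y ]>").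

Fact rank1_subproof u v : (fun x => hact u <[v, x]>) \in @adjointable _ _ H.
Proof.
apply/asboolP; exists (fun x => hact v <[u, x]>) => x y.
by rewrite hinner_act hinner_actl hinner_star.
Qed.

Definition rank1 u v : adjOp H := AdjOp (rank1_subproof u v).

Lemma rank1E u v x : rank1 u v x = hact u <[v, x]>. Proof. by []. Qed.

Lemma rank1_adjoint u v : adjoint_of (rank1 v u) (rank1 u v).
Proof. by move=> x y; rewrite !rank1E hinner_act hinner_actl hinner_star. Qed.

Lemma rank1_selfadj v : selfadj (rank1 v v).
Proof. exact: rank1_adjoint. Qed.

Lemma rank1_norm u v x : `|rank1 u v x| <= 6 * (`|u| * `|v|) * `|x|.
Proof.
rewrite rank1E (le_trans (hact_norm _ _))// -mulrA mulrCA -!mulrA ler_wpM2l//.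
by rewrite mulrCA (le_trans (hinner_norm _ _))// mulrCA.
Qed.

Lemma rank1_bounded u v : op_bounded (rank1 u v).
Proof.
exists (6 * (`|u| * `|v|) + 1); first by rewrite ltr_wpDl// !mulr_ge0.
move=> x; rewrite (le_trans (rank1_norm u v x))// ler_wpM2r//.
by rewrite lerDl.
Qed.

Lemma adjOp_hact S x a : S (hact x a) = hact (S x) a.
Proof.
by apply: (@hinner_inj _ A H) => z; rewrite hinner_act -!adjOp_starP hinner_act.
Qed.

Lemma rank1_conj S T v :
  adjoint_of S T -> T * rank1 v v * S = rank1 (T v) (T v).
Proof.
move=> /adjointable_sym TS; apply: adjOpP => x.
by rewrite !adjOpM !rank1E adjOp_hact TS.
Qed.

Lemma rank1Z k v :
  k \is Num.real -> rank1 (k *: v) (k *: v) = k ^+ 2 *: rank1 v v.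
Proof.
move=> /CrealP kr; apply: adjOpP => x.
by rewrite adjOpZ !rank1E hinnerZl hactZl hactZr kr scalerA.
Qed.

Lemma rank1_sqr v : rank1 v v * rank1 v v = rank1 (hact v <[v, v]>) v.
Proof. by apply: adjOpP => x; rewrite adjOpM !rank1E hinner_act hactM. Qed.

End RankOne.

(** * Positivity in the algebra of scalars *)

(** [A] as a Hilbert module over itself: left multiplications are adjointable
    operators, so that the results on [adjOp] apply to elements of [A]. *)
Definition regular_module (R : realType) (A : cstarAlgType R) : Type := A.

Section RegularModule.
Variables (R : realType) (A : cstarAlgType R).
Implicit Types a b : A.

HB.instance Definition _ := CompleteNormedModule.copy (regular_module A) A.

Local Notation M := (regular_module A).

Let act (x : M) (a : A) : M := cmul (x : A) a.
Let inner (x y : M) : A := cmul (cstar (x : A)) y.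

Fact regular_actDl (x y : M) a : act (x + y) a = act x a + act y a.
Proof. exact: cmulDl. Qed.
Fact regular_actDr (x : M) a b : act x (a + b) = act x a + act x b.
Proof. exact: cmulDr. Qed.
Fact regular_actM (x : M) a b : act x (cmul a b) = act (act x a) b.
Proof. exact: cmulA. Qed.
Fact regular_actZl (k : R[i]) (x : M) a : act (k *: x) a = k *: act x a.
Proof. exact: cmulZl. Qed.
Fact regular_actZr (k : R[i]) (x : M) a : act x (k *: a) = k *: act x a.
Proof. exact: cmulZr. Qed.
Fact regular_innerDr (x y z : M) : inner x (y + z) = inner x y + inner x z.
Proof. exact: cmulDr. Qed.
Fact regular_innerZr (k : R[i]) (x y : M) : inner x (k *: y) = k *: inner x y.
Proof. exact: cmulZr. Qed.
Fact regular_inner_act (x y : M) a : inner x (act y a) = cmul (inner x y) a.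
Proof. exact: cmulA. Qed.
Fact regular_inner_star (x y : M) : cstar (inner x y) = inner y x.
Proof. by rewrite /inner cstarM cstarK. Qed.
Fact regular_inner_ge0 (x : M) : cpositive (inner x x).
Proof. by exists x. Qed.
Fact regular_inner_eq0 (x : M) : inner x x = 0 -> x = 0.
Proof. exact: cmul_star_eq0. Qed.
Fact regular_norm_inner (x : M) : `|x| ^+ 2 = `|inner x x|.
Proof. by rewrite /inner cnorm_star. Qed.

HB.instance Definition _ := isHilbertModule.Build R A M
  regular_actDl regular_actDr regular_actM regular_actZl regular_actZr
  regular_innerDr regular_innerZr regular_inner_act regular_inner_star
  regular_inner_ge0 regular_inner_eq0 regular_norm_inner.

End RegularModule.

Section LeftMultiplication.
Variables (R : realType) (A : cstarAlgType R).
Implicit Types (a b : A) (k : R[i]).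

Local Notation M := (regular_module A).

Fact lmul_subproof a :
  (fun x : M => cmul a (x : A) : M) \in @adjointable _ _ M.
Proof.
apply/asboolP; exists (fun x : M => cmul (cstar a) (x : A) : M) => x y.
by rewrite /hinner /= cstarM cstarK cmulA.
Qed.

Definition lmul a : adjOp M := AdjOp (lmul_subproof a).

Lemma lmulE a (x : M) : lmul a x = cmul a (x : A). Proof. by []. Qed.

Lemma lmulD a b : lmul (a + b) = lmul a + lmul b.
Proof. by apply: adjOpP => x; rewrite adjOpD !lmulE cmulDl. Qed.

Lemma lmulZ k a : lmul (k *: a) = k *: lmul a.
Proof. by apply: adjOpP => x; rewrite adjOpZ !lmulE cmulZl. Qed.

Lemma lmulN a : lmul (- a) = - lmul a.
Proof. by apply: adjOpP => x; rewrite adjOpN !lmulE cmulNl. Qed.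

Lemma lmulM a b : lmul (cmul a b) = lmul a * lmul b.
Proof. by apply: adjOpP => x; rewrite adjOpM !lmulE cmulA. Qed.

Lemma lmul_selfadj a : cstar a = a -> selfadj (lmul a).
Proof. by move=> sa x y; rewrite !lmulE /hinner /= cstarM sa cmulA. Qed.

Lemma lmul_norm a (x : M) : `|lmul a x| <= `|a| * `|x|.
Proof. exact: cnormM. Qed.

Lemma lmul_bounded a : op_bounded (lmul a).
Proof.
exists (`|a| + 1) => [|x]; first by rewrite ltr_wpDl.
by rewrite (le_trans (lmul_norm a x))// ler_wpM2r// lerDl.
Qed.

Lemma psd_norm_sub_lmul a k : cstar a = a -> `|a| <= k ->
  psd (k *: (1 : adjOp M) - lmul a).
Proof.
move=> sa ak; apply: psd_norm_sub; first exact: lmul_selfadj.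
  exact: le_trans ak.
by move=> x; rewrite (le_trans (lmul_norm a x))// ler_wpM2r.
Qed.

Lemma psd_lmul_sqr a : cstar a = a -> psd (lmul (cmul a a)).
Proof.
by move=> sa; rewrite lmulM; apply: psd_sqr (lmul_selfadj sa) (lmul_bounded a).
Qed.

Lemma rank1_regular (x : M) : rank1 x x = lmul (cmul (x : A) (cstar (x : A))).
Proof. by apply: adjOpP => y; rewrite rank1E lmulE -cmulA. Qed.

End LeftMultiplication.

Section KelleyVaught.
Variables (R : realType) (A : cstarAlgType R).

Local Notation M := (regular_module A).

(** Let [c = <v, v>]. If [rank1 v v] is negative, [1 + rank1 v v] is the square
    of a contraction [Q], so [c + c ^+ 2 = <Q v, Q v>] has norm at most
    [`|v| ^+ 2 = `|c|]. If moreover [c] is positive, the spectrum shows that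
    [c + c ^+ 2] has norm [`|c| + `|c| ^+ 2], whence [c = 0]. *)
Lemma rank1_neg_eq0_small (H : hilbertModType A) (v : H) :
  contraction (rank1 v v) ->
  psd (lmul (hinner v v : A)) -> psd (- rank1 v v) -> v = 0.
Proof.
set th := rank1 v v; set c := hinner v v : A; set a := lmul c.
move=> cth pa pth; have sath : selfadj th := @rank1_selfadj _ _ H v.
have sc : cstar c = c by rewrite /c hinner_star.
have nc : `|c| = `|v| ^+ 2 by rewrite hnorm_inner.
have [Q [saQ cQ QE]] : exists Q, [/\ selfadj Q, contraction Q & Q * Q = 1 + th].
  apply: psd_le1_sqrt; last by rewrite opprD addrA subrr add0r.
  rewrite -[th]opprK; apply: contraction_psd; first exact: selfadjN.
  exact: contractionN.
have ncc : `|c + cmul c c| <= `|c|.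
  have -> : c + cmul c c = hinner (Q v) (Q v).
    rewrite saQ -adjOpM QE adjOpD adjOp1 hinnerDr.
    by rewrite /th rank1E hinner_act.
  by rewrite -hnorm_inner nc lerXn2r// nnegrE.
apply: contrapT => /eqP v0.
have c0 : 0 < `|c| by rewrite nc exprn_gt0// normr_gt0.
set k := `|c| in c0 ncc.
have ncc2 : `|cmul c c| = k ^+ 2 by rewrite -{1}sc cnorm_star.
have p1 : psd (k *: (1 : adjOp M) - a) by apply: psd_norm_sub_lmul.
have p2 : psd (k *: (1 : adjOp M) - (a + a * a)).
  rewrite -lmulM -lmulD; apply: psd_norm_sub_lmul => //.
  by rewrite cstarD cstarM sc.
have p3 : psd (a * (k *: (1 : adjOp M) - a)).
  apply: psdM => //; apply: commrB; last exact: commr_refl.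
  by rewrite /GRing.comm adjOpZAl adjOpZAr mulr1 mul1r.
have k1 : 0 < 1 + k by rewrite addr_gt0.
have s1 : 0 < sqrtC (1 + k) by rewrite sqrtC_gt0.
(* [k ^+ 2 - (1 + k) a ^+ 2 = k (k - a - a ^+ 2) + a (k - a)] is positive; this
   bounds [`|a|] by [k / sqrt (1 + k) < k] *)
have cs : contraction ((sqrtC (1 + k) / k) *: a).
  apply: contraction_of_sqr.
    apply: selfadjZ; last exact: lmul_selfadj.
    by rewrite gtr0_real// divr_gt0.
  have -> : 1 - ((sqrtC (1 + k) / k) *: a) ^+ 2 =
      k^-1 ^+ 2 *: (k *: (k *: (1 : adjOp M) - (a + a * a))
        + a * (k *: (1 : adjOp M) - a)).
    have -> : k *: (k *: (1 : adjOp M) - (a + a * a))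
        + a * (k *: (1 : adjOp M) - a) =
        (k * k) *: (1 : adjOp M) - (1 + k) *: (a * a).
      rewrite mulrBr adjOpZAr mulr1 scalerBr scalerDr scalerA -addrA.
      congr (_ + _); rewrite opprD addrACA addNr add0r -opprD; congr (- _).
      by rewrite addrC scalerDl scale1r.
    rewrite scalerBr !scalerA expr2 adjOpZAl adjOpZAr scalerA mulrACA -!expr2.
    by rewrite sqrtCK -exprMn mulVf ?gt_eqF// expr1n scale1r (mulrC (1 + k)).
  apply: psdZ; first by rewrite exprn_gt0 ?invr_gt0.
  by apply: psdD => //; apply: psdZ.
have := cs c; rewrite adjOpZ normrZ gtr0_norm ?divr_gt0//.
rewrite [`|a c|]ncc2 expr2 mulrA divfK ?gt_eqF//.
rewrite -[leRHS]mul1r ler_pM2r// => s_le1.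
have : 1 + k <= 1 by rewrite -(sqrtCK (1 + k)) expr_le1// ltW.
by rewrite gerDl => /(lt_le_trans c0); rewrite ltxx.
Qed.

(** Scaling [v] makes [rank1 v v] a contraction: the factor [e] satisfies
    [e ^+ 2 * (6 * `|v| ^+ 2) <= 1], where 6 is the constant of
    [hinner_norm]. *)
Lemma rank1_neg_eq0 (H : hilbertModType A) (v : H) :
  psd (lmul (hinner v v : A)) -> psd (- rank1 v v) -> v = 0.
Proof.
move=> pc pth; pose e : R[i] := (1 + 3 * `|v|)^-1.
have d0 : 0 < 1 + 3 * `|v| by rewrite ltr_pwDl// mulr_ge0.
have e0 : 0 < e by rewrite invr_gt0.
have er : e \is Num.real by rewrite gtr0_real.
have eE : hinner (e *: v) (e *: v) = e ^+ 2 *: (hinner v v : A).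
  by rewrite hinnerZl hinnerZr scalerA (CrealP er).
have ev0 : e *: v = 0.
  apply: rank1_neg_eq0_small; rewrite ?eE ?lmulZ ?rank1Z// -?scalerN.
  - move=> x; rewrite adjOpZ normrZ gtr0_norm ?exprn_gt0//.
    apply: (@le_trans _ _ (e ^+ 2 * (6 * (`|v| * `|v|) * `|x|))).
      by rewrite ler_wpM2l ?rank1_norm// exprn_ge0// ltW.
    rewrite [leLHS]mulrA ler_piMl// exprVn mulrC ler_pdivrMr ?exprn_gt0// mul1r.
    rewrite sqrrD expr1n exprMn -expr2 -natrX mul1r.
    apply: (@le_trans _ _ (9 * `|v| ^+ 2)); first by rewrite ler_wpM2r ?ler_nat.
    by rewrite lerDr addr_ge0// mulrn_wge0// mulr_ge0.
  - by apply: psdZ => //; rewrite exprn_gt0.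
  - by apply: psdZ => //; rewrite exprn_gt0.
by move/eqP : ev0; rewrite scaler_eq0 gt_eqF//= => /eqP.
Qed.

(** By [psd_or_negative], either [rank1 w w] is positive or some
    [n * rank1 w w * n] is negative; the latter is [rank1 (n w) (n w)], which
    [rank1_neg_eq0] makes zero. *)
Lemma rank1_psd_of (H : hilbertModType A) (w : H) :
  (forall v : H, psd (- rank1 v v) -> psd (lmul (hinner v v : A))) ->
  psd (rank1 w w).
Proof.
move=> psd_inner.
have [n [P [san [saP bP] nZn Pimp]]] :=
  psd_or_negative (@rank1_selfadj _ _ H w) (rank1_bounded w w).
move: nZn; rewrite (rank1_conj _ san) => nw.
have pnw : psd (- rank1 (n w) (n w)) by rewrite nw opprK; apply: psd_sqr.
apply/Pimp/(selfadj_sqr_eq0 saP)/oppr_inj; rewrite oppr0 -nw.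
rewrite (rank1_neg_eq0 (psd_inner _ pnw) pnw).
apply: adjOpP => x.
by rewrite rank1E hinner0l -(scale0r (0 : A)) hactZr scale0r.
Qed.

(** The theorem of Kelley and Vaught. On the module [A], left multiplication by
    [d^* d] is the rank one operator of [d^*], and the hypothesis of
    [rank1_psd_of] comes from the symmetry of [v^* v + v v^*]. *)
Lemma psd_lmul_star (d : A) : psd (lmul (cmul (cstar d) d)).
Proof.
have -> : lmul (cmul (cstar d) d) =
    rank1 (cstar d : M) (cstar d : M).
  by rewrite rank1_regular cstarK.
(* [v^* v = (p^2 + q^2) / 2 - v v^*], with [p / 2] the real part of [v] and
   [- q / 2] its imaginary part *)
apply: rank1_psd_of => v pv.
pose p : A := (v : A) + cstar (v : A).
pose q : A := 'i *: ((v : A) - cstar (v : A)).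
have sp : cstar p = p by rewrite cstarD cstarK addrC.
have sq : cstar q = q.
  by rewrite cstarZ conjCi cstarD cstarN cstarK scaleNr -scalerN opprB.
have -> : (hinner v v : A) =
    2^-1 *: (cmul p p + cmul q q) - cmul (v : A) (cstar (v : A)).
  rewrite /hinner/= cmulZl cmulZr scalerA -expr2 sqrCi scaleN1r.
  rewrite !cmulDl !cmulDr !cmulNl !cmulNr.
  have key (a b c f : A) :
      a + b + (c + f) - (a - b + (- c - - f)) = 2 *: (b + c).
    rewrite opprK !opprD !opprK addrACA [a + b + _]addrACA subrr add0r.
    by rewrite [c + f + _]addrACA subrr addr0 -!mulr2n -mulrnDl scaler_nat.
  by rewrite key scalerA mulVf ?pnatr_eq0// scale1r addrAC subrr add0r.
have -> : lmul (2^-1 *: (cmul p p + cmul q q) - cmul (v : A) (cstar (v : A))) =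
    2^-1 *: (lmul (cmul p p) + lmul (cmul q q)) + (- rank1 v v).
  by rewrite rank1_regular !(lmulD, lmulZ, lmulN).
apply: psdD pv; apply: psdZ; rewrite ?invr_gt0//.
by apply: psdD; apply: psd_lmul_sqr.
Qed.

Lemma rank1_psd (H : hilbertModType A) (w : H) : psd (rank1 w w).
Proof.
apply: rank1_psd_of => v _.
by have [d ->] := hinner_ge0 v; apply: psd_lmul_star.
Qed.

End KelleyVaught.

(** * Positive functionals *)

Section PositiveFunctionals.
Variables (R : realType) (A : cstarAlgType R) (H : hilbertModType A).
Implicit Types (S T : adjOp H) (f : {scalar adjOp H}).

Definition positive_functional f := forall S, psd S -> 0 <= f S.

Lemma positive_functional_norm_selfadj f S (k : R[i]) :
  positive_functional f -> selfadj S -> 0 <= k ->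
  (forall x, `|S x| <= k * `|x|) -> (f S \is Num.real) && (`|f S| <= k * f 1).
Proof.
move=> fpos saS k0 Sk.
have := fpos _ (psd_norm_sub saS k0 Sk).
rewrite raddfB/= scalarZ subr_ge0 => le1.
have Nk x : `|(- S) x| <= k * `|x| by rewrite adjOpN normrN.
have := fpos _ (psd_norm_sub (selfadjN saS) k0 Nk).
rewrite raddfB/= raddfN/= scalarZ opprK -lerBlDr sub0r => le2.
have f1 : k * f 1 \is Num.real.
  by rewrite rpredM ?ger0_real// fpos//; exact: psd1.
have fr : f S \is Num.real by rewrite (ler_real le1).
by rewrite fr real_ler_norml// le1 lerNl le2.
Qed.

(** The factor 2 pays for treating the real and the imaginary part of [T]
    separately. *)
Lemma positive_functional_bound f S T (k : R[i]) :
  positive_functional f -> adjoint_of S T -> 0 <= k ->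
  (forall x, `|T x| <= k * `|x|) -> (forall x, `|S x| <= k * `|x|) ->
  f S = Num.conj (f T) /\ `|f T| <= 2 * k * f 1.
Proof.
move=> fpos ST k0 Tk Sk.
have TS := adjointable_sym ST.
have sa1 : selfadj (T + S).
  by move=> x y; rewrite !adjOpD hinnerDl hinnerDr ST TS addrC.
have sa2 : selfadj ('i *: (T - S)).
  move=> x y; rewrite !adjOpZ !adjOpB hinnerZl hinnerZr conjCi.
  by rewrite hinnerBl hinnerBr ST TS scaleNr -scalerN opprB.
have k20 : 0 <= 2 * k by rewrite mulr_ge0.
have b1 x : `|(T + S) x| <= 2 * k * `|x|.
  rewrite adjOpD (le_trans (ler_normD _ _))// -mulrA mulr_natl mulr2n.
  exact: lerD.
have b2 x : `|('i *: (T - S)) x| <= 2 * k * `|x|.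
  rewrite adjOpZ normrZ normCi mul1r adjOpB (le_trans (ler_normB _ _))//.
  by rewrite -mulrA mulr_natl mulr2n lerD.
have /andP[/CrealP r1 n1] := positive_functional_norm_selfadj fpos sa1 k20 b1.
have /andP[/CrealP r2 n2] := positive_functional_norm_selfadj fpos sa2 k20 b2.
have i2 : 'i * 'i = -1 :> R[i] by rewrite -expr2 sqrCi.
split.
  move: r1 r2; rewrite scalarZ raddfD/= raddfB/= rmorphM/= conjCi.
  rewrite rmorphD rmorphB/=.
  move=> r1 r2; have {}r2 : Num.conj (f T) - Num.conj (f S) = f S - f T.
    by apply: (mulfI (neq0Ci _)); rewrite -[LHS]opprK -mulNr r2 -mulrN opprB.
  have := congr2 +%R r1 r2; rewrite addrACA subrr addr0 [f T + _]addrC.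
  rewrite addrACA subrr addr0 -!mulr2n => /eqP.
  by rewrite eqr_pMn2r// => /eqP.
have fT : 2 * f T = f (T + S) - 'i * f ('i *: (T - S)).
  rewrite scalarZ mulrA i2 mulN1r opprK raddfD/= raddfB/=.
  by rewrite addrACA subrr addr0 mulr_natl mulr2n.
rewrite -(@ler_pM2l _ 2)// -{1}[2]ger0_norm// -normrM fT.
rewrite (le_trans (ler_normB _ _))// normrM normCi mul1r.
rewrite -[in leRHS]mulrA [leRHS]mulr_natl mulr2n.
by rewrite !mulrA lerD.
Qed.

Definition detects_psd (F : set {scalar adjOp H}) :=
  forall S, selfadj S -> op_bounded S -> (forall f, F f -> 0 <= f S) -> psd S.

End PositiveFunctionals.

Lemma norm_le_rotations (R : realType) (w t : R[i]) : 0 <= t ->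
  (forall l : R[i], `|l| = 1 -> l * w + Num.conj (l * w) <= 2 * t) <->
  `|w| <= t.
Proof.
move=> t0; split=> [rot|wt l l1]; last first.
  have -> : l * w + Num.conj (l * w) = 2 * 'Re (l * w).
    by rewrite ReE [RHS]mulrC divfK// pnatr_eq0.
  rewrite ler_pM2l// (le_trans (leif_Re_Creal _).1)// normrM l1 mul1r//.
have [->|w0] := eqVneq w 0; first by rewrite normr0.
have nw : `|w| != 0 by rewrite normr_eq0.
have := rot (Num.conj w / `|w|).
rewrite normrM norm_conjC normfV normr_id divff//.
have -> : Num.conj w / `|w| * w = `|w|.
  by rewrite mulrAC [_ * w]mulrC -normCK expr2 mulfK.
move=> /(_ erefl); rewrite (CrealP (normr_real _)) -mulr2n -[leLHS]mulr_natl.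
by rewrite ler_pM2l.
Qed.

Section NumericalRadius.
Variables (R : realType) (A : cstarAlgType R) (H : hilbertModType A).
Implicit Types (S T : adjOp H) (F G : set {scalar adjOp H}).

(** Rotating [T] turns the bound on absolute values into positivity of the
    self-adjoint operators [2 t - (l T + (l T)^* )], and positivity does not
    depend on the family of functionals that tests it. *)
Lemma numerical_bound_transfer F G T (t : R[i]) : 0 <= t ->
  (forall S : adjOp H, op_bounded S) ->
  (forall f, F f -> positive_functional f) ->
  (forall f, G f -> positive_functional f) -> detects_psd F ->
  (forall f, F f -> `|f T| <= t * f 1) -> forall f, G f -> `|f T| <= t * f 1.
Proof.
move=> t0 bdd Fpos Gpos Fdet FT.
pose T' := adjOp_star T; have T'P : adjoint_of T' T := @adjOp_starP _ _ H T.
have TP := adjointable_sym T'P.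
have [k k0 [Tk T'k]] := op_bounded_common (bdd T) (bdd T').
pose S (l : R[i]) := (2 * t) *: (1 : adjOp H) - (l *: T + Num.conj l *: T').
have fS (f : {scalar adjOp H}) l : positive_functional f ->
    f (S l) = 2 * (t * f 1) - (l * f T + Num.conj (l * f T)).
  move=> fpos.
  have [fT' _] := positive_functional_bound fpos T'P (ltW k0) Tk T'k.
  by rewrite raddfB/= raddfD/= !scalarZ fT' rmorphM mulrA.
have f1 (f : {scalar adjOp H}) : positive_functional f -> 0 <= t * f 1.
  by move=> fpos; rewrite mulr_ge0// fpos//; exact: psd1.
have pS l : `|l| = 1 -> psd (S l).
  move=> l1; apply: Fdet => //.
    apply: selfadjB; first by apply: selfadjZ; rewrite ?ger0_real ?mulr_ge0.
    move=> x y; rewrite !adjOpD !adjOpZ hinnerDl hinnerDr !hinnerZl !hinnerZr.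
    by rewrite TP T'P conjCK addrC.
  move=> f Ff; rewrite fS ?subr_ge0; last exact: Fpos.
  have /(@norm_le_rotations R _ _ (f1 f (Fpos f Ff))) := FT f Ff.
  exact.
move=> g Gg; apply/(@norm_le_rotations R _ _ (f1 g (Gpos g Gg))) => l l1.
by rewrite -subr_ge0 -fS; [exact/Gpos/pS | exact: Gpos].
Qed.

End NumericalRadius.

(** * Vector functionals of a representation *)

Section Representation.
Variables (R : realType) (A : cstarAlgType R) (H : hilbertModType A).
Variables (X : hilbertType R) (pi : representation H X).
Implicit Types (S T : adjOp H) (x y z : H) (xi eta : X).

Lemma bddOp_linear (S : bddOp X) : linear S.
Proof. by have /asboolP[] := valP S. Qed.

HB.instance Definition _ (S : bddOp X) :=
  GRing.isLinear.Build R[i] X X *:%R S (bddOp_linear S).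

Lemma bddOp_funZ (S : bddOp X) (k : R[i]) xi : S (k *: xi) = k *: S xi.
Proof. exact: linearZ. Qed.

Lemma repM S T xi : pi (S * T) xi = pi S (pi T xi).
Proof. by rewrite [S * T]/(adjOp_comp S T) rep_comp. Qed.

Lemma repN S xi : pi (- S) xi = - pi S xi.
Proof. by rewrite raddfN. Qed.

Lemma rep0 xi : pi 0 xi = 0.
Proof. by rewrite raddf0. Qed.

Lemma adjOp_star_eq S T : adjoint_of S T -> adjOp_star T = S.
Proof.
move=> ST; apply: adjOpP => x; apply: (@hinner_inj _ A H) => y.
by rewrite -hinner_star adjOp_starP -ST hinner_star.
Qed.

Lemma rep_adjoint S T : adjoint_of S T -> bdd_adjoint_of (pi S) (pi T).
Proof. by move=> /adjOp_star_eq <-; exact: rep_star. Qed.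

Lemma rep_selfadj S xi eta :
  selfadj S -> dotp (pi S xi) eta = dotp xi (pi S eta).
Proof. by move=> /rep_adjoint. Qed.

Definition vector_functional xi (T : adjOp H) : R[i] := dotp (pi T xi) xi.

Fact vector_functional_scalar xi : scalar (vector_functional xi).
Proof.
by move=> k S T; rewrite /vector_functional linearP/= linearDl linearZl_LR.
Qed.

HB.instance Definition _ xi := GRing.isLinear.Build R[i] (adjOp H) R[i] *%R
  (vector_functional xi) (vector_functional_scalar xi).

Lemma vector_functional_psd xi : positive_functional (vector_functional xi).
Proof.
move=> S /psd_sqrt[Q [pQ <- _]]; rewrite /= /vector_functional repM.
by rewrite rep_selfadj; [exact: dnorm_ge0 | exact: psd_selfadj].
Qed.

Lemma dotp_norm_eq0 xi : dotp xi xi = 0 -> xi = 0.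
Proof. by move=> /eqP; rewrite dnorm_eq0 => /eqP. Qed.

Lemma vector_functional1 xi :
  vector_functional xi 1 = dotp (pi 1 xi) (pi 1 xi).
Proof.
by rewrite /vector_functional -(rep_selfadj _ _ (@selfadj1 _ _ H)) -repM mulr1.
Qed.

(** [pi 1] is an orthogonal projection, possibly not the identity. *)
Lemma vector_functional1_le xi : vector_functional xi 1 <= dotp xi xi.
Proof.
have p0 : 0 <= vector_functional xi 1 by rewrite vector_functional1 dnorm_ge0.
have := dnorm_ge0 dotp (xi - pi 1 xi).
rewrite dnormB/= -vector_functional1 -rep_selfadj//.
rewrite -[dotp (pi 1 xi) xi]/(vector_functional xi 1) (CrealP (ger0_real p0)).
by rewrite opprD addrA addrK subr_ge0.
Qed.

Lemma vector_functional_proj xi T :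
  vector_functional xi T = vector_functional (pi 1 xi) T.
Proof.
rewrite /vector_functional -rep_selfadj// -!repM.
by rewrite mulr1 mul1r.
Qed.

(** The vectors on the right are not normalized; [xi] is first replaced by
    [pi 1 xi], whose squared norm is the value of the functional at 1. *)
Lemma vector_functionals_bound T (t : R[i]) : 0 <= t ->
  (forall xi, `|xi| = 1 -> `|vector_functional xi T| <= t) <->
  (forall xi, `|vector_functional xi T| <= t * vector_functional xi 1).
Proof.
move=> t0; split=> bnd xi; last first.
  move=> xi1; rewrite (le_trans (bnd xi))// ler_piMr//.
  by rewrite (le_trans (vector_functional1_le xi))// -norm_dotp xi1 expr1n.
rewrite vector_functional1 vector_functional_proj -norm_dotp.
set eta := pi 1 xi; have [->|eta0] := eqVneq eta 0.
  by rewrite /vector_functional linear0r normr0 mulr_ge0.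
have n0 : `|eta| != 0 by rewrite normr_eq0.
have r0 : 0 < `|eta| by rewrite normr_gt0.
have /bnd : `| `|eta|^-1 *: eta| = 1 by rewrite normrZ normfV normr_id mulVf.
have -> : vector_functional (`|eta|^-1 *: eta) T =
    `|eta|^-1 ^+ 2 * vector_functional eta T.
  rewrite /vector_functional bddOp_funZ linearZl_LR/= linearZr_LR/=.
  rewrite geC0_conj ?invr_ge0//.
  by rewrite mulrA -expr2.
rewrite normrM ger0_norm ?exprn_ge0 ?invr_ge0// exprVn mulrC.
by rewrite ler_pdivrMr// exprn_gt0.
Qed.

Hypothesis pi_inj : faithful pi.

Lemma rep_eq0 S : (forall xi, pi S xi = 0) -> S = 0.
Proof.
by move=> S0; apply: pi_inj; apply/val_inj/funext => xi /=; rewrite S0 rep0.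
Qed.

Lemma vector_functionals_detect :
  detects_psd (range (fun xi => vector_functional xi : {scalar adjOp H})).
Proof.
move=> S saS bS pos.
have [n [P [san [saP _] nSn Ppsd]]] := psd_or_negative saS bS.
apply/Ppsd/rep_eq0 => xi; apply: dotp_norm_eq0; apply/le_anti.
rewrite dnorm_ge0 andbT -oppr_ge0.
have := pos _ (imageT _ (pi n xi)); rewrite /= /vector_functional.
rewrite -rep_selfadj// -!repM nSn repN repM linearNl.
by rewrite /= rep_selfadj.
Qed.

(** The operator [rank1 (T x) (T x) = T * rank1 x x * T^*] has the image
    [pi T * pi (rank1 x x) * pi T^*], which is at most a multiple of
    [`|x| ^+ 2] because [pi T^*] is bounded. Detection of positivity brings
    this bound back to [H], where [rank1 y y] has size [`|y| ^+ 2]. *)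
Lemma adjOp_bounded T : op_bounded T.
Proof.
have /asboolP[_ [N0 TN0]] := valP (pi (adjOp_star T)).
have [N N_gt0 TN] : exists2 N : R[i], 0 < N &
    forall xi, `|pi (adjOp_star T) xi| <= N * `|xi|.
  exists (`|N0| + 1) => [|xi]; first by rewrite ltr_wpDl.
  have [->|xi0] := eqVneq xi 0.
    by rewrite -(scale0r 0) bddOp_funZ !scale0r !normr0 mulr0.
  have xi_gt0 : 0 < `|xi| by rewrite normr_gt0.
  have := TN0 xi; rewrite -!ler_pdivrMr// => le0.
  rewrite (le_trans le0)// (le_trans (real_ler_norm _)) ?lerDl//.
  by rewrite -(ler_real le0) ger0_real// divr_ge0.
exists (6 * N) => [|x]; first by rewrite mulr_gt0.
have [->|x0] := eqVneq x 0; first by rewrite adjOp_fun0 !normr0 mulr0.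
set y := T x.
have T'T : adjoint_of (adjOp_star T) T := @adjOp_starP _ _ H T.
pose k : R[i] := 6 * (`|x| * `|x|); pose L : R[i] := k * N ^+ 2.
have k0 : 0 < k by rewrite !mulr_gt0 ?normr_gt0.
have L0 : 0 < L by rewrite mulr_gt0 ?exprn_gt0.
have pL : psd (L *: (1 : adjOp H) - rank1 y y).
  apply: vector_functionals_detect.
  - apply: selfadjB; last exact: rank1_selfadj.
    by apply: selfadjZ; rewrite ?gtr0_real.
  - apply: op_boundedD; last exact/op_boundedN/rank1_bounded.
    exact/op_boundedZ/contraction_bounded/contraction1.
  - move=> _ [xi _ <-]; rewrite raddfB/= scalarZ subr_ge0 -(rank1_conj _ T'T).
    rewrite /= vector_functional1 vector_functional_proj; set eta := pi 1 xi.
    pose zeta := pi (adjOp_star T) eta.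
    have -> : vector_functional eta (T * rank1 x x * adjOp_star T) =
        vector_functional zeta (rank1 x x).
      rewrite /vector_functional !repM.
      by rewrite (rep_adjoint (adjointable_sym T'T)).
    have /andP[zr zn] := positive_functional_norm_selfadj
      (@vector_functional_psd zeta) (@rank1_selfadj _ _ H x) (ltW k0)
      (rank1_norm x x).
    rewrite (le_trans (real_ler_norm zr))// (le_trans zn)// /L -[leRHS]mulrA.
    rewrite ler_wpM2l ?(ltW k0)// (le_trans (vector_functional1_le _))//.
    rewrite -!norm_dotp -exprMn lerXn2r ?nnegrE ?mulr_ge0 ?(ltW N_gt0)//.
    exact: TN.
have yL := psd_le_norm L0 (rank1_psd y) pL y.
have [->|y0] := eqVneq y 0; first by rewrite normr0 !mulr_ge0// ltW.
have y_gt0 : 0 < `|y| by rewrite normr_gt0.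
rewrite -(@ler_pXn2r _ 2)// ?nnegrE ?mulr_ge0 ?(ltW N_gt0)//.
have -> : (6 * N * `|x|) ^+ 2 = 6 * L by rewrite /L /k; ring.
rewrite -(@ler_pM2r _ (`|y| ^+ 2)) ?exprn_gt0//.
have -> : `|y| ^+ 2 * `|y| ^+ 2 = `|(hinner y (rank1 y y y) : A)|.
  rewrite rank1E hinner_act -{1}(hinner_star y y) cnorm_star.
  by rewrite hnorm_inner expr2.
rewrite (le_trans (hinner_norm _ _))// -mulrA ler_wpM2l//.
by rewrite expr2 [leRHS]mulrCA ler_wpM2l// yL.
Qed.

End Representation.

(** * States *)

Lemma normc_norm (R : realType) (w : R[i]) : (normc w)%:C = `|w|.
Proof. by []. Qed.

Section States.
Variables (R : realType) (A : cstarAlgType R) (H : hilbertModType A).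
Implicit Types (S T : adjOp H) (x y z : H) (rho : {scalar A}).

Definition state_functional x rho (T : adjOp H) : R[i] := rho (hinner x (T x)).

Fact state_functional_scalar x rho : scalar (state_functional x rho).
Proof.
move=> k S T; rewrite /state_functional adjOpD adjOpZ hinnerDr hinnerZr.
by rewrite raddfD/= scalarZ.
Qed.

HB.instance Definition _ x rho := GRing.isLinear.Build R[i] (adjOp H) R[i] *%R
  (state_functional x rho) (state_functional_scalar x rho).

Lemma state_functional_psd x rho : is_state rho ->
  positive_functional (state_functional x rho).
Proof.
move=> [rho_pos _] S /psd_sqrt[Q [[saQ _] <- _]].
by rewrite /= /state_functional adjOpM -saQ; apply/rho_pos/hinner_ge0.
Qed.

Lemma state_functional1 x rho : state_functional x rho 1 = rho (hinner x x).
Proof. by []. Qed.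

(** Vectors are rescaled to [rho <x, x> = 1]. This fails when [rho <x, x> = 0],
    and then the functional vanishes on bounded operators. *)
Lemma state_functionals_bound T (t : R[i]) :
  0 <= t -> (forall S : adjOp H, op_bounded S) ->
  (forall x rho, is_state rho -> rho (hinner x x) = 1 ->
     `|rho (hinner x (T x))| <= t) <->
  (forall x rho, is_state rho ->
     `|state_functional x rho T| <= t * state_functional x rho 1).
Proof.
move=> t0 bdd; split=> bnd x rho rhoP; last first.
  by move=> x1; have := bnd x rho rhoP; rewrite state_functional1 x1 mulr1.
have [k k0 [Tk T'k]] := op_bounded_common (bdd T) (bdd (adjOp_star T)).
have [_] := positive_functional_bound (@state_functional_psd x rho rhoP)
  (@adjOp_starP _ _ H T) (ltW k0) Tk T'k.
rewrite /= !state_functional1.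
set s := rho (hinner x x).
have s0 : 0 <= s := @state_functional_psd x rho rhoP 1 (@psd1 _ _ H).
have [->|sn0] := eqVneq s 0; first by rewrite !mulr0.
move=> _; have s_gt0 : 0 < s by rewrite lt_def sn0.
have q0 : 0 < sqrtC s by rewrite sqrtC_gt0.
have qr : Num.conj (sqrtC s)^-1 = (sqrtC s)^-1.
  by rewrite geC0_conj// invr_ge0 ltW.
have q2 : (sqrtC s)^-1 * (sqrtC s)^-1 = s^-1.
  by rewrite -expr2 exprVn sqrtCK.
have := bnd ((sqrtC s)^-1 *: x) rho rhoP.
rewrite adjOp_funZ !hinnerZl !hinnerZr qr !scalerA q2 !scalarZ mulVf//.
by rewrite normrM normfV (ger0_norm s0) mulrC ler_pdivrMr//; apply.
Qed.

End States.

Section StateExistence.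
Variables (R : realType) (A : cstarAlgType R) (H : hilbertModType A).
Variables (X : hilbertType R) (pi : representation H X).
Implicit Types (S T : adjOp H) (x y z : H) (a : A).

(** The factor [c] is there to normalize the functional to a state. *)
Definition induced_functional (c : R[i]) (xi : X) z a : R[i] :=
  c * vector_functional pi xi (rank1 (hact z a) z).

Fact induced_functional_scalar c xi z : scalar (induced_functional c xi z).
Proof.
move=> k a b; rewrite /induced_functional.
have -> : rank1 (hact z (k *: a + b)) z =
    k *: rank1 (hact z a) z + rank1 (hact z b) z.
  apply: adjOpP => x.
  by rewrite adjOpD adjOpZ !rank1E hactDr hactZr hactDl hactZl.
by rewrite vector_functional_scalar mulrDr mulrCA.
Qed.

HB.instance Definition _ c xi z := GRing.isLinear.Build R[i] A R[i] *%R
  (induced_functional c xi z) (induced_functional_scalar c xi z).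

(** For [a = d^* d] the operator [x |-> z a <z, x>] is [rank1 w w] with
    [w = z d^* ]. *)
Lemma induced_functional_ge0 c xi z a : 0 <= c -> cpositive a ->
  0 <= induced_functional c xi z a.
Proof.
move=> c0 [d ->]; rewrite mulr_ge0//.
have -> : rank1 (hact z (cmul (cstar d) d)) z =
    rank1 (hact z (cstar d)) (hact z (cstar d)).
  by apply: adjOpP => x; rewrite !rank1E hinner_actl cstarK -!hactM cmulA.
exact: (@vector_functional_psd _ _ _ _ pi xi) (rank1_psd _).
Qed.

Lemma induced_functional_bound xi z : exists2 K : R[i], 0 <= K &
  forall a, `|induced_functional 1 xi z a| <= K * `|a|.
Proof.
have f1 : 0 <= vector_functional pi xi 1.
  exact: (@vector_functional_psd _ _ _ _ pi xi) (@psd1 _ _ H).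
exists (12 * (`|z| * `|z|) * vector_functional pi xi 1).
  by rewrite !mulr_ge0.
move=> a; rewrite /induced_functional mul1r.
pose k : R[i] := 6 * (`|z| * `|z|) * `|a|.
have k0 : 0 <= k by rewrite !mulr_ge0.
have za : `|hact z a| * `|z| <= `|z| * `|z| * `|a|.
  by rewrite mulrAC ler_wpM2r// hact_norm.
have [x|x|_] := positive_functional_bound (@vector_functional_psd _ _ _ _ pi xi)
  (@rank1_adjoint _ _ H (hact z a) z) k0.
- rewrite (le_trans (rank1_norm _ _ _))// ler_wpM2r// /k -mulrA ler_wpM2l//.
- rewrite (le_trans (rank1_norm _ _ _))// ler_wpM2r// /k -mulrA ler_wpM2l//.
  by rewrite mulrC.
move/le_trans; apply; rewrite le_eqVlt; apply/orP; left; apply/eqP.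
by rewrite /k; ring.
Qed.

(** At [a = <z, z>] the induced functional is the squared norm of
    [pi (rank1 z z) xi], and some [xi] makes it nonzero since [pi] is
    injective. *)
Lemma exists_state z : faithful pi -> z <> 0 ->
  exists2 rho : {scalar A}, is_state rho & 0 < rho (hinner z z).
Proof.
move=> pi_inj z0.
have [xi xi0] : exists xi, pi (rank1 z z) xi <> 0.
  apply: contrapT => /forallNP no; apply: z0.
  have th0 : rank1 z z = 0 by apply: (rep_eq0 pi_inj) => xi; apply: contrapT.
  apply: (@hinner_eq0 _ A H); apply: cmul_star_eq0.
  have := hinner0r z; rewrite -(adjOp0 z) -th0 rank1E hinner_act.
  by rewrite hinner_star.
pose f : A -> R[i] := induced_functional 1 xi z.
pose c : A := hinner z z.
have fc : 0 < f c.
  rewrite /f /induced_functional mul1r /c -rank1_sqr /vector_functional repM.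
  rewrite rep_selfadj; last exact: rank1_selfadj.
  by rewrite dnorm_gt0; apply/eqP.
have [K K0 fK] := induced_functional_bound xi z.
pose E : set R := [set normc (f a) | a in [set a : A | `|a| <= 1]].
have E0 : E !=set0.
  by exists (normc (f 0)); exists 0 => //=; rewrite normr0.
have Eub : has_ubound E.
  exists (complex.Re K) => _ [a /= a1 <-].
  rewrite -lecR normc_norm RRe_real ?ger0_real//.
  by rewrite (le_trans (fK a))// ler_piMr.
have Esup : has_sup E by [].
pose s := sup E.
have c_gt0 : 0 < `|c|.
  rewrite normr_gt0; apply/eqP => c0; move: fc.
  by rewrite c0 /f linear0 ltxx.
have Es t : E t -> t <= s by move=> Et; apply: ub_le_sup.
have s0 : 0 < s.
  have /Es : E (normc (f (`|c|^-1 *: c))).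
    exists (`|c|^-1 *: c) => //=.
    by rewrite normrZ normfV normr_id mulVf ?gt_eqF.
  apply: lt_le_trans; rewrite -ltcR normc_norm /f scalarZ normr_gt0.
  by rewrite mulf_neq0 ?invr_eq0 ?gt_eqF//.
have sc0 : 0 <= (s^-1)%:C by rewrite lecR invr_ge0 ltW.
have fE a : induced_functional (s^-1)%:C xi z a = (s^-1)%:C * f a.
  by rewrite /f /induced_functional mul1r.
exists (induced_functional (s^-1)%:C xi z : {scalar A}); last first.
  by rewrite /= fE mulr_gt0// ltcR invr_gt0.
split=> [a|]; first exact: induced_functional_ge0.
set E1 := [set _ | _ in _].
have nE1 a : normc (induced_functional (s^-1)%:C xi z a) = s^-1 * normc (f a).
  apply: complexI; rewrite rmorphM.
  have : `|induced_functional (s^-1)%:C xi z a| = (s^-1)%:C * `|f a|.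
    by rewrite fE normrM ger0_norm.
  exact.
have E10 : E1 !=set0.
  exists (normc (induced_functional (s^-1)%:C xi z 0)).
  by exists 0 => //=; rewrite normr0.
have E1le : ubound E1 1.
  move=> _ [a a1 <-]; rewrite /= nE1 mulrC ler_pdivrMr// mul1r.
  by apply: Es; exists a.
apply/le_anti/andP; split; first exact: ge_sup.
rewrite -(ler_pM2l s0) mulr1; apply: ge_sup => // _ [a a1 <-].
rewrite -ler_pdivrMl// -nE1; apply: ub_le_sup; first by exists 1.
by exists a.
Qed.

Lemma state_functionals_detect : faithful pi ->
  detects_psd [set f : {scalar adjOp H} | exists x (rho : {scalar A}),
    is_state rho /\ f = state_functional x rho].
Proof.
move=> pi_inj S saS bS pos.
have [n [P [san [saP _] nSn Ppsd]]] := psd_or_negative saS bS.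
apply/Ppsd/adjOpP => y; apply: contrapT => /(exists_state pi_inj) [rho rhoP].
have := pos (state_functional (n y) rho)
  (ex_intro _ _ (ex_intro _ _ (conj rhoP erefl))).
rewrite /= /state_functional san -!adjOpM nSn adjOpN adjOpM hinnerNr raddfN/=.
by rewrite -saP oppr_ge0 => /le_lt_trans /[apply]; rewrite ltxx.
Qed.

End StateExistence.

(** * Equality of the two radii *)

(** The supremum of an empty or unbounded set of reals is 0 by convention, so
    such sets are treated apart. *)
Lemma sup_le_of_ubounds (R : realType) (E F : set R) :
  (forall r, F r -> 0 <= r) ->
  (forall t, 0 <= t -> ubound E t <-> ubound F t) ->
  sup E <= sup F.
Proof.
move=> F0 EF.
have supE_le t : 0 <= t -> ubound E t -> sup E <= t.
  move=> t0 Et; have [->|/set0P E0] := eqVneq E set0; first by rewrite sup0.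
  exact: ge_sup.
have [hF|nF] := pselect (has_sup F).
  have F_ub : ubound F (sup F) by apply: sup_upper_bound.
  have sF : 0 <= sup F.
    by have [[r Fr] _] := hF; apply: le_trans (F0 r Fr) (F_ub r Fr).
  by apply: supE_le => //; apply/(EF _ sF).
rewrite (sup_out nF); have [F_eq0|/set0P Fn0] := eqVneq F set0.
  by apply: supE_le => //; apply/(EF _ (lexx 0)); rewrite F_eq0.
rewrite sup_out// => -[_ [t Et]]; apply: nF; split => //.
exists (Num.max t 0); apply/EF; first by rewrite le_max lexx orbT.
by move=> r Er; rewrite le_max Et.
Qed.

Theorem theorem3p2 (R : realType) (A : cstarAlgType R) (H : hilbertModType A)
    (X : hilbertType R) (pi : representation H X) :
  faithful pi ->
  forall T : adjOp H, spatial_numerical_radius T = numerical_radius (pi T).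
Proof.
move=> pi_inj T.
pose F := [set f : {scalar adjOp H} | exists x (rho : {scalar A}),
  is_state rho /\ f = state_functional x rho].
pose G := range (fun xi => vector_functional pi xi : {scalar adjOp H}).
have bdd := adjOp_bounded pi_inj.
have Fpos f : F f -> positive_functional f.
  by move=> [x [rho [rhoP ->]]]; apply: state_functional_psd.
have Gpos f : G f -> positive_functional f.
  by move=> [xi _ <-]; apply: vector_functional_psd.
have Fdet : detects_psd F := state_functionals_detect pi_inj.
have Gdet : detects_psd G := vector_functionals_detect pi_inj.
pose E1 := [set r : R | exists (x : H) (rho : {scalar A}),
  [/\ is_state rho, rho (hinner x x) = 1 & r = normc (rho (hinner x (T x)))]].
pose E2 := [set normc (dotp (pi T xi) xi) | xi in [set xi : X | `|xi| = 1]].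
have E1P t : 0 <= t -> ubound E1 t <-> (forall f, F f -> `|f T| <= t%:C * f 1).
  rewrite -lecR => t0.
  split=> [Et _ [x [rho [rhoP ->]]]|Ft _ [x [rho [rhoP x1 ->]]]].
    apply: (proj1 (state_functionals_bound T t0 bdd)) rhoP => {}x {}rho rhoP x1.
    by rewrite -normc_norm lecR; apply: Et; exists x, rho.
  rewrite -lecR normc_norm.
  apply: (proj2 (state_functionals_bound T t0 bdd)) rhoP x1 => {}x {}rho rhoP.
  by apply: Ft; exists x, rho.
have E2P t : 0 <= t -> ubound E2 t <-> (forall f, G f -> `|f T| <= t%:C * f 1).
  rewrite -lecR => t0; split=> [Et _ [xi _ <-]|Gt _ [xi xi1 <-]].
    apply: (proj1 (vector_functionals_bound pi T t0)) => {}xi xi1.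
    by rewrite -normc_norm lecR; apply: Et; exists xi.
  rewrite -lecR normc_norm.
  apply: (proj2 (vector_functionals_bound pi T t0)) xi1 => {}xi.
  by apply: Gt; exists xi.
have normc_ge0 (w : R[i]) : 0 <= normc w by case: w => a b; exact: sqrtr_ge0.
have E12 t : 0 <= t -> ubound E1 t <-> ubound E2 t.
  move=> t0; have tc0 : 0 <= t%:C by rewrite lecR.
  by split=> [/(E1P _ t0)|/(E2P _ t0)] bnd; [apply/(E2P _ t0)|apply/(E1P _ t0)];
    apply: (numerical_bound_transfer tc0 bdd _ _ _ bnd).
have E1_ge0 r : E1 r -> 0 <= r by move=> [x [rho [_ _ ->]]].
have E2_ge0 r : E2 r -> 0 <= r by move=> [xi _ <-].
apply/le_anti/andP; split; apply: sup_le_of_ubounds => // t t0.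
by split=> /(E12 _ t0).
Qed.
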